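(* Fix $\theta\in\mathbb{R}$ and let $\mathbf{T}=(T_1,\dots,T_N)$ be $N$ i.i.d. observations from $f(\cdot|G,\theta)$ (model in the context). Then a Bayes estimate of the unimodal density $f(t|G,\theta)$ is given by the posterior mean given $\theta$ and $\mathbf{T}$, $$\mathbb{E}[f(t|G,\theta)|\theta,\mathbf{T}]=\sum_{\mathbf{S}^+}\sum_{\mathbf{S}^-}a_f(t|\mathbf{S}^-,\mathbf{S}^+,\theta,\mathbf{T})\,\pi(\mathbf{S}^-,\mathbf{S}^+|\theta,\mathbf{T}),$$ the sums being over all $\mathbf{S}$-paths $\mathbf{S}^+$ of $n+1$ coordinates and $\mathbf{S}^-$ of $N-n+1$ coordinates, where $$a_f(t|\mathbf{S}^-,\mathbf{S}^+,\theta,\mathbf{T})=\Big[\eta_0(\mathbf{S}^+,\mathbf{S}^-)d^+_{\theta,0}(t)+\sum_{j=1}^n\eta_j^+(\mathbf{S}^+,\mathbf{S}^-)d^+_{\theta,j}(t|\mathbf{S}^+)\Big]\mathbb{I}(t>\theta)+\Big[\eta_0(\mathbf{S}^+,\mathbf{S}^-)d^-_{\theta,0}(t)+\sum_{j=1}^{N-n}\eta_j^-(\mathbf{S}^+,\mathbf{S}^-)d^-_{\theta,j}(t|\mathbf{S}^-)\Big]\mathbb{I}(t<\theta),$$ with $d^+_{\theta,0}(t)=\int_{t-\theta}^\infty X^{-1}H(dX)$, $d^-_{\theta,0}(t)=\int_{-\infty}^{t-\theta}(-X)^{-1}H(dX)$, for $j=1,\dots,n$, $$d^+_{\theta,j}(t|\mathbf{S}^+)=\frac{\int_{\max(t-\theta,Y_j)}^\infty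 U^{-(S_j^+-S_{j-1}^++1)}H(dU)}{\int_{Y_j}^\infty U^{-(S_j^+-S_{j-1}^+)}H(dU)}\ \text{ if }S_j^+>S_{j-1}^+,\qquad d^+_{\theta,j}(t|\mathbf{S}^+)=0\ \text{ otherwise},$$ and, for $j=1,\dots,N-n$, $$d^-_{\theta,j}(t|\mathbf{S}^-)=\frac{\int_{-\infty}^{\min(t-\theta,Z_j)}(-V)^{-(S_j^--S_{j-1}^-+1)}H(dV)}{\int_{-\infty}^{Z_j}(-V)^{-(S_j^--S_{j-1}^-)}H(dV)}\ \text{ if }S_j^->S_{j-1}^-,\qquad d^-_{\theta,j}(t|\mathbf{S}^-)=0\ \text{ otherwise}.$$
   Context: Species sampling model. $G$ is a random probability measure on $\mathbb{R}$ of the form $G(\cdot)=\sum_k W_k\delta_{\xi_k}(\cdot)+(1-\sum_kW_k)H(\cdot)$, where $H$ is a non-atomic probability measure on $\mathbb{R}$, the $\xi_k$ are i.i.d. $H$, and the random weights $0<W_k<1$, $\sum_kW_k\le1$, are independent of the $\xi_k$. If $X_1,\dots,X_N$ are i.i.d. from $G$ given $G$, with partition $\mathbf{p}=\{C_1,\dots,C_{N(\mathbf{p})}\}$ of $\{1,\dots,N\}$ into the classes of equal values, $C_k=\{j:X_j=X_k^*\}$, $X_k^*$ the unique values, $e_k=|C_k|$, then the joint law of $(X_1,\dots,X_N)$ is $\pi(\mathbf{p})\prod_{k=1}^{N(\mathbf{p})}H(dX_k^* )$ with $\pi(\mathbf{p})=\chi(e_1,\dots,e_{N(\mathbf{p})})$.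 Here $\chi$ is a symmetric function of finite lists of positive integers (the exchangeable partition probability function of $G$, defined for every sample size); $\chi$ of the empty list is $1$. Model. Given $G$ and $\theta$, the $T_k$ are i.i.d. with density $f(t|G,\theta)=\int X^{-1}[\mathbb{I}(0<t-\theta\le X)-\mathbb{I}(X\le t-\theta<0)]\,G(dX)$, $t\in\mathbb{R}$. $\mathbb{I}$ is the indicator. Ordering. The values $T_1-\theta,\dots,T_N-\theta$ are (almost surely) distinct and nonzero and are listed as $\mathbf{Z}=(Z_{N-n},\dots,Z_1)$, $Z_{N-n}<\dots<Z_1<0$, and $\mathbf{Y}=(Y_1,\dots,Y_n)$, $0<Y_1<\dots<Y_n$; so $n$ depends on $\theta$ and $\mathbf{T}$. $\mathbf{S}$-paths. An $\mathbf{S}$-path of $n+1$ coordinates is an integer vector $\mathbf{S}=(S_0,\dots,S_n)$ with $S_0=0$, $S_n=n$, $S_j\le j$ and $S_j\le S_{j+1}$ for $j=1,\dots,n-1$. A partition of $\{1,\dots,n\}$ corresponds to $\mathbf{S}$ if the maximal elements of its cells are exactly the $j$ with $S_j>S_{j-1}$ and the cell with maximal element $j$ has size $S_j-S_{j-1}$. $\mathbb{C}_{\mathbf{S}}$ is the set of partitions corresponding to $\mathbf{S}$; $|\mathbb{C}_{\mathbf{S}}|=\prod_{j:S_j>S_{j-1}}\binom{j-1-S_{j-1}}{j-S_j}$. $\mathcal{M}_{a,b}(\mathbf{S})$ is the list (multiset) $\{S_j-S_{j-1}:S_j>S_{j-1},\ a\le j\le b\}$; $\chi(\mathcal{M},\mathcal{M}')$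 is $\chi$ evaluated at the concatenated list, and $\mathcal{M}\backslash\{m\}$ removes one copy of $m$. The path distribution is $\pi(\mathbf{S}^-,\mathbf{S}^+|\theta,\mathbf{T})\propto\phi^+_\theta(\mathbf{S}^+,\mathbf{T})\,\phi^-_\theta(\mathbf{S}^-,\mathbf{S}^+,\mathbf{T})$ (normalized over all pairs of paths), with $$\phi^+_\theta(\mathbf{S}^+,\mathbf{T})=|\mathbb{C}_{\mathbf{S}^+}|\,\chi(\mathcal{M}_{1,n}(\mathbf{S}^+))\prod_{j:S_j^+>S_{j-1}^+}\int_{Y_j}^{\infty}U^{-(S_j^+-S_{j-1}^+)}H(dU),$$ $$\phi^-_\theta(\mathbf{S}^-,\mathbf{S}^+,\mathbf{T})=|\mathbb{C}_{\mathbf{S}^-}|\,\frac{\chi(\mathcal{M}_{1,n}(\mathbf{S}^+),\mathcal{M}_{1,N-n}(\mathbf{S}^-))}{\chi(\mathcal{M}_{1,n}(\mathbf{S}^+))}\prod_{j:S_j^->S_{j-1}^-}\int_{-\infty}^{Z_j}(-V)^{-(S_j^--S_{j-1}^-)}H(dV).$$ Prediction weights. With $D=\chi(\mathcal{M}_{1,n}(\mathbf{S}^+),\mathcal{M}_{1,N-n}(\mathbf{S}^-))$, $$\eta_0(\mathbf{S}^+,\mathbf{S}^-)=\chi(\mathcal{M}_{1,n}(\mathbf{S}^+),\mathcal{M}_{1,N-n}(\mathbf{S}^-),1)/D;$$ for $j=1,\dots,n$, $\eta_j^+(\mathbf{S}^+,\mathbf{S}^-)=\chi(\mathcal{M}_{1,n}(\mathbf{S}^+)\backslash\{S_j^+-S_{j-1}^+\},\mathcal{M}_{1,N-n}(\mathbf{S}^-),S_j^+-S_{j-1}^++1)/D$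 if $S_j^+>S_{j-1}^+$, and $0$ otherwise; for $j=1,\dots,N-n$, $\eta_j^-(\mathbf{S}^+,\mathbf{S}^-)=\chi(\mathcal{M}_{1,n}(\mathbf{S}^+),\mathcal{M}_{1,N-n}(\mathbf{S}^-)\backslash\{S_j^--S_{j-1}^-\},S_j^--S_{j-1}^-+1)/D$ if $S_j^->S_{j-1}^-$, and $0$ otherwise. Conditional laws given $(\theta,\mathbf{T})$ are the versions given by Bayes' formula, for $\mathbf{T}$ of positive marginal density; a pair of paths for which some factor in $\phi^+_\theta\phi^-_\theta$ (including a denominator) vanishes has probability zero and contributes zero to the sum. *)

(* Defs.v *)
From HB Require Import structures.
From mathcomp Require Import all_boot all_order all_algebra.
From mathcomp Require Import all_classical all_reals all_analysis.

Set Implicit Arguments.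
Unset Strict Implicit.
Unset Printing Implicit Defensive.
Import Order.TTheory GRing.Theory Num.Theory.
Import numFieldNormedType.Exports.

Local Open Scope classical_set_scope.
Local Open Scope ring_scope.

(* The atoms and weights of the random measure are indexed by the k : nat satisfying K, so
   that finite as well as countably infinite families of weights are covered. *)

Definition family_events (d : measure_display) (Omega : measurableType d)
    (R : realType) (K : pred nat) (V : nat -> {mfun Omega >-> R}) :
    set (set Omega) :=
  <<s [set E | exists k (B : set R),
         [/\ K k, measurable B & E = V k @^-1` B]] >>.

Record species_sampling_model (d : measure_display) (Omega : measurableType d)
    (R : realType) (P : probability Omega R) (H : probability R R)
    (K : pred nat) (W xi : nat -> {RV P >-> R}) (G : R.-pker Omega ~> R) :
    Prop := SpeciesSamplingModel {
  ssm_nonatomic : forall x : R, H [set x] = 0%E ;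
  ssm_atoms_iid : forall (s : seq nat) (A : nat -> set R),
    uniq s -> all K s -> (forall k, measurable (A k)) ->
    P (\big[setI/setT]_(k <- s) (xi k @^-1` A k)) = (\prod_(k <- s) H (A k))%E ;
  ssm_weights_indep : forall E F : set Omega,
    family_events K W E -> family_events K xi F ->
    P (E `&` F) = (P E * P F)%E ;
  ssm_form : {ae P, forall w,
    [/\ forall k, K k -> 0 < W k w < 1,
        (\sum_(0 <= k <oo | K k) (W k w)%:E <= 1)%E
      & forall A : set R, measurable A ->
          G w A = (\sum_(0 <= k <oo | K k) (W k w)%:E * \d_(xi k w) A
                   + (1 - \sum_(0 <= k <oo | K k) (W k w)%:E) * H A)%E]} }.

(* The n-fold product measure of mu, evaluated by iterated integration. *)
Fixpoint iid_law (R : realType) (mu : {measure set R -> \bar R}) (n : nat) :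
    set (n.-tuple R) -> \bar R :=
  match n with
  | 0 => fun A => (\1_A [tuple])%:E
  | m.+1 => fun A =>
      (\int[mu]_x @iid_law R mu m [set y : m.-tuple R | A [tuple of x :: y]])%E
  end.

(* chi is the exchangeable partition probability function of G: for a sample of
   any size n drawn i.i.d. from G given G, the partition of the sample into
   classes of equal values is p with probability chi e, where e lists the sizes
   of the cells of p in an arbitrary order. *)
Definition is_eppf (d : measure_display) (Omega : measurableType d)
    (R : realType) (P : probability Omega R) (G : R.-pker Omega ~> R)
    (chi : seq nat -> R) : Prop :=
  forall (n : nat) (p : {set {set 'I_n}}) (e : seq nat),
    finset.partition p [set: 'I_n]%SET ->
    perm_eq e [seq #|C| | C : {set 'I_n} in p] ->
    (\int[P]_w iid_law (G w)
       [set x : n.-tuple R | preim_partition (tnth x) [set: 'I_n]%SET = p])%E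
    = (chi e)%:E.

Definition density (R : realType) (G : {measure set R -> \bar R})
    (theta t : R) : R :=
  \int[G]_x (x^-1 * ((0 < t - theta <= x)%R%:R - (x <= t - theta < 0)%R%:R)).

Definition likelihood (R : realType) (G : {measure set R -> \bar R})
    (theta : R) (N : nat) (T : N.-tuple R) : R :=
  \prod_(i < N) density G theta (tnth T i).

Definition marginal_density (d : measure_display) (Omega : measurableType d)
    (R : realType) (P : probability Omega R) (G : R.-pker Omega ~> R)
    (theta : R) (N : nat) (T : N.-tuple R) : R :=
  \int[P]_w likelihood (G w) theta T.

(* Bayes' formula for the conditional mean of h given theta and T. *)
Definition posterior_mean (d : measure_display) (Omega : measurableType d)
    (R : realType) (P : probability Omega R) (G : R.-pker Omega ~> R)
    (theta : R) (N : nat) (T : N.-tuple R) (h : Omega -> R) : R :=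
  (\int[P]_w (h w * likelihood (G w) theta T)) / marginal_density P G theta T.

(* Y_1 < Y_2 < ... and Z_1 > Z_2 > ... are the entries 0, 1, ... of the lists
   Ypos and Zneg. *)
Definition Ypos (R : realType) (theta : R) (N : nat) (T : N.-tuple R) : seq R :=
  sort <=%R [seq x <- [seq s - theta | s <- T] | 0 < x].

Definition Zneg (R : realType) (theta : R) (N : nat) (T : N.-tuple R) : seq R :=
  sort >=%R [seq x <- [seq s - theta | s <- T] | x < 0].

Definition Yj (R : realType) (theta : R) (N : nat) (T : N.-tuple R) (j : nat) :
  R := nth 0 (Ypos theta T) j.-1.

Definition Zj (R : realType) (theta : R) (N : nat) (T : N.-tuple R) (j : nat) :
  R := nth 0 (Zneg theta T) j.-1.

Definition npos (R : realType) (theta : R) (N : nat) (T : N.-tuple R) : nat :=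
  size (Ypos theta T).

(* S-paths of n + 1 coordinates: the constraints force 0 <= S_j <= n. *)
Definition int_path (n : nat) := {ffun 'I_n.+1 -> 'I_n.+1}.

Definition pcoord (n : nat) (S : int_path n) (j : nat) : nat := S (inord j).

Definition is_Spath (n : nat) (S : int_path n) : bool :=
  [&& pcoord S 0 == 0%N, pcoord S n == n
    & [forall j : 'I_n, (0 < j)%N ==>
         ((pcoord S j <= j) && (pcoord S j <= pcoord S j.+1))%N]].

Definition jump (n : nat) (S : int_path n) (j : nat) : bool :=
  (pcoord S j.-1 < pcoord S j)%N.

Definition incr (n : nat) (S : int_path n) (j : nat) : nat :=
  (pcoord S j - pcoord S j.-1)%N.

(* The element j of {1, ..., n} is represented by the ordinal of value j - 1. *)
Definition is_cell_max (n : nat) (C : {set 'I_n}) (i : 'I_n) : bool :=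
  (i \in C) && [forall k in C, (k <= i)%N].

Definition corresponds (n : nat) (S : int_path n) (p : {set {set 'I_n}}) :
    bool :=
  [forall i : 'I_n, [exists C in p, is_cell_max C i] == jump S i.+1]
  && [forall C in p, forall i : 'I_n, is_cell_max C i ==> (#|C| == incr S i.+1)].

Definition partitions_of_path (n : nat) (S : int_path n) :
    {set {set {set 'I_n}}} :=
  [set p | finset.partition p [set: 'I_n]%SET && corresponds S p]%SET.

Definition Mlist (n : nat) (a b : nat) (S : int_path n) : seq nat :=
  [seq incr S j | j <- index_iota a b.+1 & jump S j].

Definition upper_int (R : realType) (H : probability R R) (m : nat) (y : R) :
  R := \int[H]_(u in `[y, +oo[) u ^- m.

Definition lower_int (R : realType) (H : probability R R) (m : nat) (z : R) :
  R := \int[H]_(v in `]-oo, z]) (- v) ^- m.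

Section PathFormulas.
Context (R : realType) (H : probability R R) (chi : seq nat -> R).
Context (theta : R) (N : nat) (T : N.-tuple R).

Local Notation n := (npos theta T).
Local Notation m := (N - npos theta T)%N.
Local Notation Y := (Yj theta T).
Local Notation Z := (Zj theta T).
Local Notation Mp Sp := (Mlist 1 n Sp).
Local Notation Mm Sm := (Mlist 1 m Sm).

Definition phi_pos (Sp : int_path n) : R :=
  #|partitions_of_path Sp|%:R * chi (Mp Sp)
  * \prod_(1 <= j < n.+1 | jump Sp j) upper_int H (incr Sp j) (Y j).

Definition phi_neg (Sm : int_path m) (Sp : int_path n) : R :=
  #|partitions_of_path Sm|%:R * (chi (Mp Sp ++ Mm Sm) / chi (Mp Sp))
  * \prod_(1 <= j < m.+1 | jump Sm j) lower_int H (incr Sm j) (Z j).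

Definition path_distr (Sm : int_path m) (Sp : int_path n) : R :=
  (phi_pos Sp * phi_neg Sm Sp)
  / \sum_(Sp' : int_path n | is_Spath Sp')
      \sum_(Sm' : int_path m | is_Spath Sm') phi_pos Sp' * phi_neg Sm' Sp'.

Definition eta0 (Sp : int_path n) (Sm : int_path m) : R :=
  chi (Mp Sp ++ Mm Sm ++ [:: 1%N]) / chi (Mp Sp ++ Mm Sm).

Definition eta_pos (j : nat) (Sp : int_path n) (Sm : int_path m) : R :=
  if jump Sp j then
    chi (rem (incr Sp j) (Mp Sp) ++ Mm Sm ++ [:: (incr Sp j).+1])
    / chi (Mp Sp ++ Mm Sm)
  else 0.

Definition eta_neg (j : nat) (Sp : int_path n) (Sm : int_path m) : R :=
  if jump Sm j then
    chi (Mp Sp ++ rem (incr Sm j) (Mm Sm) ++ [:: (incr Sm j).+1])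
    / chi (Mp Sp ++ Mm Sm)
  else 0.

Definition d_pos0 (t : R) : R := upper_int H 1 (t - theta).

Definition d_neg0 (t : R) : R := lower_int H 1 (t - theta).

Definition d_pos (j : nat) (t : R) (Sp : int_path n) : R :=
  if jump Sp j then
    upper_int H (incr Sp j).+1 (Num.max (t - theta) (Y j))
    / upper_int H (incr Sp j) (Y j)
  else 0.

Definition d_neg (j : nat) (t : R) (Sm : int_path m) : R :=
  if jump Sm j then
    lower_int H (incr Sm j).+1 (Num.min (t - theta) (Z j))
    / lower_int H (incr Sm j) (Z j)
  else 0.

Definition a_f (t : R) (Sm : int_path m) (Sp : int_path n) : R :=
  (eta0 Sp Sm * d_pos0 t
   + \sum_(1 <= j < n.+1) eta_pos j Sp Sm * d_pos j t Sp) * (theta < t)%R%:R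
  + (eta0 Sp Sm * d_neg0 t
   + \sum_(1 <= j < m.+1) eta_neg j Sp Sm * d_neg j t Sm) * (t < theta)%R%:R.

End PathFormulas.

(* Main.v *)
From HB Require Import structures.
From mathcomp Require Import all_boot all_order all_algebra.
From mathcomp Require Import ring.
Require Import Defs.

Set Implicit Arguments.
Unset Strict Implicit.
Unset Printing Implicit Defensive.
Import Order.TTheory GRing.Theory Num.Theory.

(** Conditionally on the species sampling measure G, the likelihood is a product
    of integrals of the kernels x |-> kern (T_i - theta) x against G, and
    multiplying it by the density at t adds the factor of one more observation.
    Both the marginal density and the numerator of Bayes' formula are therefore
    instances of one identity, [eppf_mixture]: for bounded nonnegative k_i,

      E (prod_i int k_i dG) = sum_p chi(p) prod_(C in p) int prod_(i in C) k_i dH,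

    the sum being over the partitions p of the index set.

    This identity holds because G = sum_l w_l nu_l almost surely, where label 0
    stands for the diffuse part (nu_0 = H) and label k + 1 for the atom xi_k.
    Expanding the product gives a series over lists of labels
    ([prod_integral_mixed]). Weights and atoms are independent and the atoms are
    i.i.d. from H, so a list of labels contributes its probability times a
    product over the cells of the partition that it induces, a point with label
    0 being alone in its cell ([label_prob_split]). On the other hand the atoms
    are almost surely distinct and H has no atoms, so a sample with given labels
    has almost surely the coincidences prescribed by its labels; hence chi(p) is
    the total probability of the lists of labels that induce p
    ([iid_law_labelled], [eppf_label_sum]).

    For the numerator, a partition of the observations and the new point arises
    from a partition of the observations by making the new point a singleton or
    by adding it to a cell ([sum_partition_insert]). The kernels of a positive
    and of a negative observation have disjoint supports, so that only the
    unions of a partition of the positive and one of the negative observations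
    contribute ([sum_partition_glue]). A product of positive kernels over a cell
    is a power of the kernel of its largest observation ([prod_kern_max]), hence
    a cell integral depends only on the maximal index and the size of the cell,
    and similarly on the negative side. The summands are therefore constant on
    the partitions corresponding to a given pair of paths, and every partition
    corresponds to exactly one path ([big_partition_path]).

    The quotients of values of chi and of cell integrals have to be read with
    x / 0 = 0. They are harmless: if a denominator vanishes, so does the numerator
    that it is paired with, because chi can only decrease when the sample grows
    ([eppf_cons_le]) and because the kernel of the new point is bounded
    ([Rintegral_mul_eq0]). *)

(** * Partitions of finite sets *)

(** A partition is determined by its blocks, that is by its equivalence relation:
    this turns equalities of partitions into pointwise boolean equalities. *)
Lemma preim_partition_eqP (T : finType) (rT : eqType) (f : T -> rT)
    (p : {set {set T}}) : partition p [set: T] ->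
  reflect (forall x y, (f x == f y) = (pblock p x == pblock p y))
          (preim_partition f [set: T] == p).
Proof.
move=> partp.
have eqB (q : {set {set T}}) : partition q [set: T] ->
    forall x y, (pblock q x == pblock q y) = (y \in pblock q x).
  by move=> /and3P[/eqP cq tq _] x y; rewrite eq_pblock // cq inE.
apply: (iffP eqP) => [<- x y|fE].
  rewrite (eqB _ (preim_partitionP _ _)) pblock_equivalence_partition ?inE //.
  by split=> // /eqP->.
rewrite -(equivalence_partition_pblock partp).
apply: eq_in_imset => x _; apply/setP => y.
by rewrite !inE fE eqB.
Qed.

Section PartitionSums.
Variables (V : nmodType).
Local Open Scope ring_scope.

(** The first term collects the partitions in which x is alone; in the others,
    the block of x loses x and remains nonempty. *)
Lemma big_partition_setU1 (T : finType) (x : T) (D : {set T})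
    (F : {set {set T}} -> V) : x \notin D ->
  \sum_(p | partition p (x |: D)) F p =
  \sum_(p | partition p D)
     (F ([set x] |: p) + \sum_(C in p) F ((x |: C) |: (p :\ C))).
Proof.
move=> xD.
have notin (p : {set {set T}}) (C : {set T}) : partition p D -> x \in C -> C \notin p.
  move=> pD xC; apply: contra xD => Cp.
  by apply: (subsetP (partitionS pD Cp)).
rewrite big_split /= (bigID (fun p : {set {set T}} => [set x] \in p)) /=.
congr (_ + _).
  rewrite (reindex_onto (fun p => [set x] |: p) (fun p => p :\ [set x])) /=; last first.
    by move=> p /andP[_ ?]; rewrite setD1K.
  apply: eq_bigl => p; rewrite setU11 andbT; apply/andP/idP => [[h /eqP e]|h].
    have := partitionD1 h (setU11 _ _); rewrite e.
    by rewrite setU1K.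
  rewrite setU1K ?notin ?set11 //; split=> //.
  apply: partitionU1 => //; last by rewrite disjoints1.
  by apply/set0Pn; exists x; rewrite set11.
rewrite pair_big_dep /=.
(* The inverse of the insertion of x into C remembers C as the block of x
   with x removed. *)
rewrite (reindex_onto (fun u : {set {set T}} * {set T} => (x |: u.2) |: (u.1 :\ u.2))
  (fun p => let B := pblock p x in ((B :\ x) |: (p :\ B), B :\ x))) /=; last first.
  move=> p /andP[h xp]; have [/eqP cp tp p0] := and3P h.
  have xc : x \in cover p by rewrite cp setU11.
  have Bp : pblock p x \in p by rewrite pblock_mem.
  have xB : x \in pblock p x by rewrite mem_pblock.
  rewrite (setD1K xB) setU1K ?setD1K //.
  rewrite !inE negb_and negbK; apply/orP; right; apply/negP => Bxp.
  have /set0Pn[y] : pblock p x :\ x != set0 by apply: contraNneq p0 => <-.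
  move=> yB; have := def_pblock tp Bxp yB.
  move: yB; rewrite !inE => /andP[_ yB].
  rewrite (def_pblock tp Bp yB) => e; move: xB.
  by rewrite e !inE eqxx.
apply: eq_bigl => -[p C] /=; apply/andP/andP => [[/andP[h xp] /eqP[]]|[h Cp]].
  move: h xp; set q := (x |: C) |: p :\ C; clearbody q => h xp <- <-.
  have [/eqP cp tp p0] := and3P h.
  have xc : x \in cover q by rewrite cp setU11.
  have Bp : pblock q x \in q by rewrite pblock_mem.
  have xB : x \in pblock q x by rewrite mem_pblock.
  split; last by rewrite setU11.
  have -> : D = (pblock q x :\ x) :|: ((x |: D) :\: pblock q x).
    have /subsetP BD := partitionS h Bp.
    apply/setP => y; have := BD y; rewrite !inE.
    have [->|yx] := eqVneq y x; first by rewrite xB (negPf xD).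
    by case: (y \in pblock q x) => //= ->.
  apply: partitionU1; first exact: partitionD1.
    apply: contraNneq xp => Bx0; suff <- : pblock q x = [set x] by [].
    by rewrite -(setD1K xB) Bx0 setU0.
  rewrite disjoint_sym -setI_eq0; apply/eqP/setP => y; rewrite !inE.
  by case: (y \in pblock q x); rewrite ?andbF.
have /subsetP CD := partitionS h Cp.
have xC : x \notin C by apply: contra xD => /CD.
set q := (x |: C) |: p :\ C.
have hq : partition q (x |: D).
  have -> : x |: D = (x |: C) :|: (D :\: C).
    apply/setP => y; have := CD y; rewrite !inE.
    by case: (y \in C) => [->|] //=; rewrite ?orbT ?orbF.
  apply: partitionU1; first exact: partitionD1.
    by apply/set0Pn; exists x; rewrite setU11.
  rewrite -setI_eq0; apply/eqP/setP => y; rewrite !inE.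
  have [->|] := eqVneq y x; first by rewrite (negPf xD) andbF.
  by case: (y \in C).
have xCq : x |: C \in q by rewrite setU11.
have -> : pblock q x = x |: C.
  by case/and3P: hq => _ tq _; apply: def_pblock tq xCq _; rewrite setU11.
rewrite setU1K // setU1K ?setD1K //; last first.
  by rewrite in_setD1 negb_and (notin _ _ h) ?orbT ?setU11.
split=> //; rewrite hq /= !inE negb_or negb_and.
rewrite (notin _ _ h) ?set11 // orbT andbT.
apply: contraTneq h => xE; rewrite /partition.
suff -> : set0 \in p by rewrite !andbF.
suff <- : C = set0 by [].
apply: contraNeq xC => /set0Pn[y yC].
have : y \in x |: C by rewrite setU1r.
by rewrite -xE inE => /eqP<-.
Qed.

Lemma big_partition_imset (I J : finType) (h : I -> J) (A : {set I})
    (F : {set {set J}} -> V) : injective h ->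
  \sum_(p | partition p (h @: A)) F p =
  \sum_(p | partition p A) F [set h @: (C : {set I}) | C in p].
Proof.
move=> hI.
have hK (C : {set I}) : h @^-1: (h @: C) = C.
  by apply/setP => i; rewrite inE mem_imset.
rewrite (reindex_onto (fun p : {set {set I}} => [set h @: (C : {set I}) | C in p])
  (fun p : {set {set J}} => [set h @^-1: (C : {set J}) | C in p])) /=.
  apply: eq_bigl => p; rewrite imset_partition // -imset_comp.
  rewrite (_ : [set _ | _ in p] = p) ?eqxx ?andbT //.
  by rewrite -[RHS]imset_id; apply: eq_imset => C /=.
move=> p h'; rewrite -imset_comp -[RHS]imset_id; apply: eq_in_imset => C Cp /=.
have /subsetP CA := partitionS h' Cp.
apply/setP => j; apply/imsetP/idP => [[i]|jC]; first by rewrite inE => ? ->.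
by have /imsetP[i iA ji] := CA _ jC; exists i; rewrite // inE -ji.
Qed.

Lemma partition_setU (T : finType) (A B : {set T}) (p q : {set {set T}}) :
  [disjoint A & B] -> partition p A -> partition q B ->
  partition (p :|: q) (A :|: B).
Proof.
move=> AB hp hq; have [/eqP cp tp p0] := and3P hp; have [/eqP cq tq q0] := and3P hq.
rewrite /partition inE negb_or p0 q0 !andbT /cover bigcup_setU.
rewrite -/(cover p) -/(cover q) cp cq eqxx /=.
have dis (C D : {set T}) : C \in p -> D \in q -> [disjoint C & D].
  by move=> /(partitionS hp) CA /(partitionS hq) DB; exact: disjointWl CA (disjointWr DB AB).
apply/trivIsetP => C D; rewrite !inE => /orP[Cp|Cq] /orP[Dp|Dq] CD.
- exact: (trivIsetP tp).
- exact: dis.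
- by rewrite disjoint_sym; exact: dis.
- exact: (trivIsetP tq).
Qed.

(** Cells that lie in one of the two parts sort themselves into a partition of A
    and a partition of B. *)
Lemma big_partition_setU (T : finType) (A B : {set T}) (F : {set {set T}} -> V) :
  [disjoint A & B] ->
  \sum_(p | partition p (A :|: B) && [forall C in p, (C \subset A) || (C \subset B)]) F p =
  \sum_(p | partition p A) \sum_(q | partition q B) F (p :|: q).
Proof.
move=> AB; rewrite pair_big /=.
have dis (C : {set T}) : C \subset A -> C \subset B -> C = set0.
  move=> CA CB; apply/eqP; rewrite -subset0.
  by move: AB; rewrite -setI_eq0 => /eqP <-; rewrite subsetI CA.
have sub (p : {set {set T}}) (A' B' : {set T}) : [disjoint A' & B'] -> partition p (A' :|: B') ->
    (forall C, C \in p -> (C \subset A') || (C \subset B')) ->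
    partition [set C in p | C \subset A'] A'.
  move=> AB' /and3P[/eqP cp tp p0] hC; apply/and3P; split.
  - rewrite eqEsubset; apply/andP; split.
      by apply/bigcupsP => C; rewrite inE => /andP[].
    apply/subsetP => x xA.
    have : x \in cover p by rewrite cp inE xA.
    case/bigcupP => C Cp xC; apply/bigcupP; exists C => //.
    rewrite inE Cp; case/orP: (hC _ Cp) => // /subsetP/(_ _ xC) xB.
    by have := disjointFr AB' xA; rewrite xB.
  - apply: trivIsetS tp; apply/subsetP => C; rewrite inE => /andP[] //.
  - by rewrite inE (negPf p0).
rewrite (reindex_onto (fun u => u.1 :|: u.2)
  (fun p : {set {set T}} => ([set C in p | C \subset A], [set C in p | C \subset B]))) /=.
  apply: eq_bigl => -[p q] /=; apply/idP/idP.
    move=> /andP[/andP[h /forall_inP hC] /eqP[]].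
    move: h hC; set r := p :|: q; clearbody r => h hC <- <-; apply/andP; split.
      exact: (sub _ A B).
    apply: (sub _ B A) => //; first by rewrite disjoint_sym.
      by rewrite setUC.
    by move=> C /hC; rewrite orbC.
  move=> /andP[hp hq]; rewrite partition_setU //=.
  have qA (C : {set T}) : C \in q -> C \subset A = false.
    move=> Cq; apply/negP => CA; have := partition_neq0 hq Cq.
    by rewrite (dis _ CA (partitionS hq Cq)) eqxx.
  have pB (C : {set T}) : C \in p -> C \subset B = false.
    move=> Cp; apply/negP => CB; have := partition_neq0 hp Cp.
    by rewrite (dis _ (partitionS hp Cp) CB) eqxx.
  apply/andP; split.
    apply/forall_inP => C; rewrite inE => /orP[/(partitionS hp)->//|/(partitionS hq)->].
    by rewrite orbT.
  apply/eqP; congr pair; apply/setP => C; rewrite !inE.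
    have [Cp|Cp] /= := boolP (C \in p); first by rewrite (partitionS hp).
    by have [/qA|] := boolP (C \in q).
  have [Cq|Cq] /= := boolP (C \in q); first by rewrite orbT (partitionS hq).
  by rewrite orbF; have [/pB|] := boolP (C \in p).
move=> p /andP[_ /forall_inP hC]; apply/setP => C; rewrite !inE -andb_orr.
by have [/hC|] := boolP (C \in p).
Qed.

End PartitionSums.

(** * Integer paths and partitions *)

Definition cell_top (n : nat) (C : {set 'I_n}) : nat := \max_(i in C) i.

(** The coordinates of the path of a partition: a jump at each maximal element,
    by the size of its cell. *)
Definition path_size (n : nat) (p : {set {set 'I_n}}) (j : nat) : nat :=
  \sum_(C in p | cell_top C < j) #|C|.

Definition path_of (n : nat) (p : {set {set 'I_n}}) : int_path n :=
  [ffun j : 'I_n.+1 => inord (path_size p j)].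

Lemma leq_cell_top (n : nat) (C : {set 'I_n}) (i : 'I_n) :
  i \in C -> i <= cell_top C.
Proof. exact: leq_bigmax_cond. Qed.

Lemma is_cell_maxE (n : nat) (C : {set 'I_n}) (i : 'I_n) :
  is_cell_max C i = (i \in C) && (cell_top C == i).
Proof.
rewrite /is_cell_max; have [iC|//] := boolP (i \in C); rewrite /=.
apply/forall_inP/eqP => [h|h k kC]; last by rewrite -h leq_cell_top.
apply/eqP; rewrite eqn_leq leq_cell_top // andbT.
by apply/bigmax_leqP => k; apply: h.
Qed.

Lemma cell_top_mem (n : nat) (C : {set 'I_n}) : C != set0 ->
  exists2 i : 'I_n, i \in C & cell_top C = i.
Proof.
move=> /set0Pn[k kC].
have [|i iC e] := @eq_bigmax_cond _ (mem C) (fun i : 'I_n => val i).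
  by apply/card_gt0P; exists k.
by exists i.
Qed.

Section PathOfPartition.
Variables (n : nat) (p : {set {set 'I_n}}).
Hypothesis hp : partition p [set: 'I_n].

Lemma cell_top_inj : {in p &, injective (@cell_top n)}.
Proof.
move=> C D Cp Dp CD; have [_ tp _] := and3P hp.
have [i iC ei] := cell_top_mem (partition_neq0 hp Cp).
have [j jD ej] := cell_top_mem (partition_neq0 hp Dp).
have eij : i = j by apply: val_inj; rewrite /= -ei -ej.
by rewrite -(def_pblock tp Cp iC) eij (def_pblock tp Dp jD).
Qed.

Lemma cell_top_lt C : C \in p -> cell_top C < n.
Proof. by move=> /(partition_neq0 hp)/cell_top_mem[i _ ->]. Qed.

Lemma sum_cell_top C : C \in p ->
  \sum_(D in p | cell_top D == cell_top C) #|D| = #|C|.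
Proof.
move=> Cp; rewrite (bigD1 C) /= ?Cp ?eqxx // big1 ?addn0 // => D.
by case/andP => /andP[Dp /eqP /(cell_top_inj Dp Cp) ->]; rewrite eqxx.
Qed.

Lemma path_sizeS j : path_size p j.+1 =
  path_size p j + \sum_(C in p | cell_top C == j) #|C|.
Proof.
rewrite /path_size (bigID (fun C => cell_top C == j)) /= addnC; congr (_ + _).
  apply: eq_bigl => C; rewrite -andbA; case: (C \in p) => //=.
  by rewrite ltnS andbC -ltn_neqAle.
apply: eq_bigl => C; rewrite -andbA; case: (C \in p) => //=.
by case: eqP => [->|]; rewrite ?andbF // ltnSn.
Qed.

Lemma path_size0 : path_size p 0 = 0.
Proof. by rewrite /path_size big_pred0 // => C; rewrite ltn0 andbF. Qed.

Lemma path_size_full : path_size p n = n.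
Proof.
rewrite -[RHS](card_ord n) -cardsT (card_partition hp).
apply: eq_bigl => C; have [Cp|//] := boolP (C \in p).
by rewrite /= cell_top_lt.
Qed.

(** The cells whose maximum is below j only contain elements below j. *)
Lemma path_size_le j : j <= n -> path_size p j <= j.
Proof.
move=> jn.
have ej : \sum_(i in [set: 'I_n]) (i < j) = j.
  under eq_bigl do rewrite inE.
  by rewrite -big_mkcond /= -(big_ord_widen n (fun=> 1)) // sum_nat_const card_ord muln1.
rewrite -[leqRHS]ej (set_partition_big p) //= /path_size big_mkcondr /=.
apply: leq_sum => C Cp; case: ifP => // h.
rewrite -sum1_card; apply: leq_sum => i iC.
by rewrite (leq_ltn_trans _ h) // leq_cell_top.
Qed.

Lemma pcoord_path_of j : j <= n -> pcoord (path_of p) j = path_size p j.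
Proof.
move=> jn; rewrite /pcoord ffunE (@inordK n j) ?ltnS // inordK //.
by rewrite ltnS (leq_trans (path_size_le jn)).
Qed.

Lemma path_of_Spath : is_Spath (path_of p).
Proof.
apply/and3P; split.
- by rewrite pcoord_path_of // path_size0.
- by rewrite pcoord_path_of // path_size_full.
- apply/forallP => j; apply/implyP => _.
  have jn := ltn_ord j; rewrite !pcoord_path_of ?(ltnW jn) // path_size_le ?(ltnW jn) //=.
  by rewrite path_sizeS leq_addr.
Qed.

(** A path is monotone and starts at 0, so that it is recovered from the jumps
    that the partition prescribes: each partition corresponds to one path. *)
Lemma mem_partitions_of_path S : is_Spath S ->
  (p \in partitions_of_path S) = (path_of p == S).
Proof.
move=> hS; rewrite inE hp /=.
apply/idP/eqP => [/andP[/forallP hj /forall_inP hi]|<-].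
  case/and3P: hS => /eqP S0 /eqP Sn /forallP hS.
  apply/ffunP => j; apply: ord_inj.
  suff : pcoord (path_of p) j = pcoord S j by rewrite /pcoord inord_val.
  have jn : j <= n by rewrite -ltnS.
  rewrite pcoord_path_of //.
  move: (j : nat) jn => {j}; elim=> [_|j IH jn]; first by rewrite S0 path_size0.
  have mS : pcoord S j <= pcoord S j.+1.
    have [->|j0] := posnP j; first by rewrite S0.
    by have := hS (Ordinal jn); rewrite /= j0 /= => /andP[].
  rewrite path_sizeS (IH (ltnW jn)) -(subnKC mS); congr (_ + _).
  have /eqP := hj (Ordinal jn).
  have [/existsP[C /andP[Cp hC]] _|/existsP hC /esym] :=
      boolP [exists C in p, is_cell_max C (Ordinal jn)].
    have := hC; rewrite is_cell_maxE => /andP[_ /eqP /= eC].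
    transitivity #|C|; first by rewrite -(sum_cell_top Cp) eC.
    by have /forallP/(_ (Ordinal jn)) := hi _ Cp; rewrite hC => /eqP.
  rewrite /jump /= => /negbT; rewrite -leqNgt -subn_eq0 => /eqP ->.
  rewrite big1 // => C /andP[Cp /eqP eC]; case: hC; exists C; rewrite Cp is_cell_maxE /=.
  rewrite eC eqxx andbT; have [i iC ei] := cell_top_mem (partition_neq0 hp Cp).
  by rewrite (_ : Ordinal jn = i) //; apply: val_inj; rewrite /= -ei.
have inc (i : 'I_n) : incr (path_of p) i.+1 = \sum_(C in p | cell_top C == i) #|C|.
  by have jn := ltn_ord i; rewrite /incr /= !pcoord_path_of ?(ltnW jn) // path_sizeS addKn.
apply/andP; split.
  apply/forallP => i; rewrite /jump -subn_gt0 -/(incr _ _) inc lt0n sum_nat_eq0.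
  rewrite negb_forall; apply/eqP; apply/existsP/existsP => -[C H]; exists C.
    case/andP: H => Cp; rewrite is_cell_maxE => /andP[iC ->].
    by rewrite Cp /= cards_eq0; apply: (partition_neq0 hp).
  move: H; rewrite negb_imply => /andP[/andP[Cp /eqP eC] _]; rewrite Cp is_cell_maxE /=.
  rewrite eC eqxx andbT; have [k kC ek] := cell_top_mem (partition_neq0 hp Cp).
  by rewrite (_ : i = k) //; apply: val_inj; rewrite /= -ek.
apply/forall_inP => C Cp; apply/forallP => i; apply/implyP.
by rewrite is_cell_maxE => /andP[_ /eqP e]; rewrite inc -e sum_cell_top.
Qed.

Lemma incr_cell_top S C : p \in partitions_of_path S -> C \in p ->
  incr S (cell_top C).+1 = #|C|.
Proof.
rewrite inE => /andP[_ /andP[_ /forall_inP h]] Cp.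
have [i iC ei] := cell_top_mem (partition_neq0 hp Cp).
have /forallP/(_ i) := h _ Cp.
by rewrite is_cell_maxE iC ei eqxx /= => /eqP ->.
Qed.

(** The cells of a partition are in bijection with the jumps of its path. This
    is how sums, products and lists over cells become the ones over jumps. *)
Lemma perm_cell_tops S : p \in partitions_of_path S ->
  perm_eq [seq (cell_top C).+1 | C <- enum p]
          [seq j <- index_iota 1 n.+1 | jump S j].
Proof.
move=> pS; apply: uniq_perm; last first.
- move=> j; rewrite mem_filter mem_index_iota.
  have := pS; rewrite inE => /andP[_ /andP[/forallP hj _]].
  apply/mapP/and3P => [[C]|[jj j0 jn]].
    rewrite mem_enum => Cp ->; have [i iC ei] := cell_top_mem (partition_neq0 hp Cp).
    split=> //; last by rewrite ltnS cell_top_lt.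
    have /eqP := hj i; rewrite ei => <-; apply/existsP; exists C.
    by rewrite Cp is_cell_maxE iC ei eqxx.
  case: j jj j0 jn => // j jj _; rewrite ltnS => jn; have /eqP := hj (Ordinal jn).
  rewrite jj => /existsP[C /andP[Cp]]; rewrite is_cell_maxE => /andP[_ /eqP e].
  by exists C; rewrite ?mem_enum // e.
- by rewrite filter_uniq // iota_uniq.
- rewrite map_inj_in_uniq ?enum_uniq // => C D.
  by rewrite !mem_enum => Cp Dp [/(cell_top_inj Cp Dp)].
Qed.

Lemma perm_Mlist S : p \in partitions_of_path S ->
  perm_eq (Mlist 1 n S) [seq #|C| | C : {set 'I_n} in p].
Proof.
move=> pS; rewrite perm_sym /Mlist.
have /(perm_map (incr S)) := perm_cell_tops pS.
rewrite -map_comp; apply: etrans; apply: (congr1 (fun s => perm_eq s _)).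
by apply/eq_in_map => C; rewrite mem_enum => /(incr_cell_top pS) <-.
Qed.

Lemma big_cell_tops (V : Type) (idx : V) (op : Monoid.com_law idx)
    (F : nat -> nat -> V) S : p \in partitions_of_path S ->
  \big[op/idx]_(C in p) F (cell_top C).+1 #|C| =
  \big[op/idx]_(1 <= j < n.+1 | jump S j) F j (incr S j).
Proof.
move=> pS; rewrite -[RHS]big_filter -[RHS](perm_big _ (perm_cell_tops pS)) /= big_map.
rewrite -[LHS]big_enum /=; apply: eq_big_seq => C; rewrite mem_enum => Cp.
by rewrite (incr_cell_top pS).
Qed.

End PathOfPartition.

Lemma big_partition_path (V : nmodType) (n : nat) (F : {set {set 'I_n}} -> V) :
  (\sum_(p | partition p [set: 'I_n]) F p =
   \sum_(S : int_path n | is_Spath S) \sum_(p in partitions_of_path S) F p)%R.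
Proof.
rewrite (partition_big (@path_of n) (@is_Spath n)); last by move=> p; apply: path_of_Spath.
apply: eq_bigr => S hS; apply: eq_bigl => p.
have [h|h] := boolP (partition p _) => /=; first by rewrite mem_partitions_of_path.
by rewrite inE (negPf h).
Qed.

(** * Sums over partitions weighted by cell sizes *)

Definition cell_sizes (T : finType) (p : {set {set T}}) : seq nat :=
  [seq #|C| | C : {set T} in p].

Lemma perm_enum_imset (T T' : finType) (f : T -> T') (A : {set T}) : injective f ->
  perm_eq (enum (f @: A)) (map f (enum A)).
Proof.
move=> fI; apply: uniq_perm => [||y].
- exact: enum_uniq.
- by rewrite map_inj_uniq ?enum_uniq.
rewrite mem_enum; apply/imsetP/mapP => -[x xA ->]; exists x => //.
  by rewrite mem_enum.
by rewrite mem_enum in xA.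
Qed.

Lemma perm_enum_setU (T : finType) (A B : {set T}) : [disjoint A & B] ->
  perm_eq (enum (A :|: B)) (enum A ++ enum B).
Proof.
move=> AB; apply: uniq_perm => [||x].
- exact: enum_uniq.
- rewrite cat_uniq !enum_uniq /= andbT; apply/hasPn => x.
  by rewrite !mem_enum => xB; rewrite (disjointFl AB).
- by rewrite mem_cat !mem_enum inE.
Qed.

Lemma cell_sizes_setU (T : finType) (p q : {set {set T}}) : [disjoint p & q] ->
  perm_eq (cell_sizes (p :|: q)) (cell_sizes p ++ cell_sizes q).
Proof. by move=> pq; rewrite -map_cat; apply: perm_map; exact: perm_enum_setU. Qed.

Lemma cell_sizes_setU1 (T : finType) (C : {set T}) (p : {set {set T}}) : C \notin p ->
  perm_eq (cell_sizes (C |: p)) (#|C| :: cell_sizes p).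
Proof.
move=> Cp; apply: perm_trans (cell_sizes_setU _) _; first by rewrite disjoints1.
by rewrite /cell_sizes /image_mem enum_set1.
Qed.

Lemma cell_sizes_setD1 (T : finType) (C : {set T}) (p : {set {set T}}) : C \in p ->
  perm_eq (#|C| :: cell_sizes (p :\ C)) (cell_sizes p).
Proof.
move=> Cp; rewrite perm_sym -{1}(setD1K Cp).
by apply: cell_sizes_setU1; rewrite setD11.
Qed.

Lemma cell_sizes_imset (T T' : finType) (h : T -> T') (p : {set {set T}}) :
  injective h -> perm_eq (cell_sizes [set h @: (C : {set T}) | C in p]) (cell_sizes p).
Proof.
move=> hI; rewrite /cell_sizes /image_mem.
apply: perm_trans (perm_map _ (perm_enum_imset _ (imset_inj hI))) _.
rewrite -map_comp (@eq_map _ _ _ (fun C : {set T} => #|C|)) // => C /=.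
by rewrite card_imset.
Qed.

Lemma cell_sizes_gt0 (T : finType) (p : {set {set T}}) (D : {set T}) :
  partition p D -> all (leq 1) (cell_sizes p).
Proof.
move=> hp; apply/allP => _ /mapP[C Cp ->]; rewrite mem_enum in Cp.
by rewrite card_gt0 (partition_neq0 hp).
Qed.

Lemma partition_subset (T : finType) (p q : {set {set T}}) (D : {set T}) :
  partition p D -> q \subset p -> partition q (cover q).
Proof.
move=> /and3P[_ tp p0] qp; rewrite /partition eqxx (trivIsetS qp tp).
by apply: contra p0; apply: (subsetP qp).
Qed.

Lemma big_imset_cells (V : Type) (idx : V) (op : Monoid.com_law idx)
    (T T' : finType) (h : T -> T') (p : {set {set T}}) (F : {set T'} -> V) :
  injective h ->
  \big[op/idx]_(C in [set h @: (C : {set T}) | C in p]) F C =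
  \big[op/idx]_(C in p) F (h @: C).
Proof. by move=> hI; apply: big_imset => C D _ _; apply: imset_inj. Qed.

Section WeightedPartitions.
Variables (R : fieldType) (chi : seq nat -> R).
Hypothesis chi_perm : forall e e', all (leq 1) e -> perm_eq e e' -> chi e = chi e'.

Local Open Scope ring_scope.

(** Summing over the partitions of a set with one more point: the point is alone
    or joins one of the cells. *)
Lemma sum_partition_insert (M : nat) (cell : {set 'I_M.+1} -> R)
    (h := lift (@ord0 M)) :
  \sum_(p | partition p [set: 'I_M.+1]) chi (cell_sizes p) * \prod_(C in p) cell C =
  \sum_(p | partition p [set: 'I_M])
    (chi (1%N :: cell_sizes p) * cell [set ord0] * \prod_(C in p) cell (h @: C)
     + \sum_(C in p) chi (#|C|.+1 :: cell_sizes (p :\ C)) * cell (ord0 |: (h @: C))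
         * \prod_(D in p :\ C) cell (h @: D)).
Proof.
have hI : injective h by exact: lift_inj.
have h0 (A : {set 'I_M}) : ord0 \notin h @: A.
  by apply/imsetP => -[i _ /eqP]; rewrite (negPf (neq_lift _ _)).
have -> : [set: 'I_M.+1] = ord0 |: (h @: [set: 'I_M]).
  apply/setP => i; rewrite !inE; case: (unliftP ord0 i) => [j|] ->.
    by rewrite imset_f ?orbT.
  by rewrite eqxx.
rewrite big_partition_setU1 // big_partition_imset //.
apply: eq_bigr => p hp; set hp' := [set h @: (C : {set 'I_M}) | C in p].
have php : partition hp' (h @: [set: 'I_M]) by rewrite imset_partition.
have n0 (q : {set {set 'I_M.+1}}) (B : {set 'I_M.+1}) :
    q \subset hp' -> ord0 \in B -> B \notin q.
  move=> /subsetP qh B0; apply/negP => /qh /imsetP[C _ e].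
  by move: B0; rewrite e (negPf (h0 _)).
congr (_ + _).
  rewrite big_setU1 ?n0 ?set11 //= mulrA; congr (_ * _ * _).
    apply: chi_perm; first by apply: (@cell_sizes_gt0 _ _ (ord0 |: (h @: [set: 'I_M])));
      apply: partitionU1 => //; rewrite ?disjoints1 ?h0 //; apply/set0Pn; exists ord0; rewrite set11.
    apply: perm_trans (cell_sizes_setU1 _) _; first by rewrite n0 ?set11.
    by rewrite cards1 perm_cons cell_sizes_imset.
  by rewrite big_imset_cells.
rewrite big_imset_cells //; apply: eq_bigr => C Cp.
have -> : hp' :\ (h @: C) = [set h @: (D : {set 'I_M}) | D in p :\ C].
  apply/setP => B; rewrite !inE; apply/andP/imsetP => [[BC /imsetP[D Dp e]]|[D]].
    exists D => //; rewrite !inE Dp andbT; apply: contraNneq BC => <-.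
    by rewrite e.
  by rewrite !inE => /andP[DC Dp] ->; rewrite (inj_eq (imset_inj hI)) DC imset_f.
have sub : [set h @: (D : {set 'I_M}) | D in p :\ C] \subset hp'.
  by apply: imsetS; exact: subsetDl.
rewrite big_setU1 ?n0 ?setU11 //= mulrA; congr (_ * _ * _).
  have e : perm_eq (cell_sizes ((ord0 |: h @: C) |: [set h @: (D : {set 'I_M}) | D in p :\ C]))
      (#|C|.+1 :: cell_sizes (p :\ C)).
    apply: perm_trans (cell_sizes_setU1 _) _; first by rewrite n0 ?setU11.
    by rewrite cardsU1 h0 card_imset // add1n perm_cons cell_sizes_imset.
  apply: chi_perm => //; rewrite (perm_all _ e) /=.
  by apply: cell_sizes_gt0 (partition_subset hp (subsetDl _ _)).
by rewrite big_imset_cells.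
Qed.

End WeightedPartitions.

(** * Partitions of a disjoint union and pairs of paths *)

Section Glue.
Variables (n m : nat).

Definition glue (p : {set {set 'I_n}}) (q : {set {set 'I_m}}) : {set {set 'I_(n + m)}} :=
  [set @lshift n m @: (C : {set 'I_n}) | C in p]
  :|: [set @rshift n m @: (C : {set 'I_m}) | C in q].

Definition straddles (C : {set 'I_(n + m)}) : bool :=
  ~~ (C \subset @lshift n m @: setT) && ~~ (C \subset @rshift n m @: setT).

Let lI : injective (@lshift n m) := @lshift_inj n m.
Let rI : injective (@rshift n m) := @rshift_inj n m.

Lemma disjoint_shifts : [disjoint @lshift n m @: setT & @rshift n m @: setT].
Proof.
rewrite -setI_eq0; apply/eqP/setP => i; rewrite !inE; apply/negP.
by case/andP => /imsetP[j _ ->] /imsetP[k _ /eqP]; rewrite eq_lrshift.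
Qed.

Lemma setT_shifts : [set: 'I_(n + m)] = @lshift n m @: setT :|: @rshift n m @: setT.
Proof.
apply/setP => i; rewrite !inE; case: (split_ordP i) => j ->.
  by rewrite imset_f.
by rewrite orbC imset_f.
Qed.

(** For the application: F vanishes on a partition with a cell that contains
    observations of both signs. *)
Lemma sum_partition_glue (V : nmodType) (F : {set {set 'I_(n + m)}} -> V) :
  (forall p C, partition p [set: 'I_(n + m)] -> C \in p -> straddles C -> F p = 0%R) ->
  (\sum_(p | partition p [set: 'I_(n + m)]) F p =
   \sum_(p | partition p [set: 'I_n]) \sum_(q | partition q [set: 'I_m]) F (glue p q))%R.
Proof.
move=> F0; set A := @lshift n m @: setT; set B := @rshift n m @: setT.
rewrite (bigID (fun p : {set {set _}} => [forall C in p, (C \subset A) || (C \subset B)])) /=.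
rewrite [X in (_ + X)%R]big1 ?GRing.addr0; last first.
  move=> p /andP[hp]; rewrite negb_forall => /existsP[C].
  by rewrite negb_imply negb_or => /andP[Cp]; apply: F0.
rewrite setT_shifts big_partition_setU ?disjoint_shifts // big_partition_imset //.
by apply: eq_bigr => p hp; rewrite big_partition_imset.
Qed.

Variables (p : {set {set 'I_n}}) (q : {set {set 'I_m}}).
Hypotheses (p0 : set0 \notin p).

Lemma disjoint_glue : [disjoint [set @lshift n m @: (C : {set 'I_n}) | C in p]
  & [set @rshift n m @: (C : {set 'I_m}) | C in q]].
Proof.
rewrite -setI_eq0; apply/eqP/setP => D; rewrite !inE; apply/negP.
case/andP => /imsetP[C Cp ->] /imsetP[E _ e].
have /set0Pn[i iC] : C != set0 by apply: contraNneq p0 => <-.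
have : lshift m i \in @rshift n m @: E by rewrite -e imset_f.
by case/imsetP => j _ /eqP; rewrite eq_lrshift.
Qed.

Lemma big_glue (V : Type) (idx : V) (op : Monoid.com_law idx)
    (F : {set 'I_(n + m)} -> V) :
  \big[op/idx]_(C in glue p q) F C =
  op (\big[op/idx]_(C in p) F (@lshift n m @: C))
     (\big[op/idx]_(C in q) F (@rshift n m @: C)).
Proof.
rewrite -(big_imset_cells _ p F lI) -(big_imset_cells _ q F rI).
rewrite -bigU; last exact: disjoint_glue.
by apply: eq_bigl => C; rewrite !inE.
Qed.

Lemma cell_sizes_glue : perm_eq (cell_sizes (glue p q)) (cell_sizes p ++ cell_sizes q).
Proof.
apply: perm_trans (cell_sizes_setU disjoint_glue) _.
by apply: perm_cat; exact: cell_sizes_imset.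
Qed.

Lemma glueD1l C : C \in p -> glue p q :\ (@lshift n m @: C) = glue (p :\ C) q.
Proof.
move=> Cp; apply/setP => D; rewrite !inE andb_orr; congr (_ || _).
  apply/andP/imsetP => [[DC /imsetP[E Ep e]]|[E]].
    by exists E; rewrite // !inE Ep andbT; apply: contraNneq DC => <-; rewrite e.
  by rewrite !inE => /andP[EC Ep] ->; rewrite (inj_eq (imset_inj lI)) EC imset_f.
have [Dq|] := boolP (_ \in _); rewrite ?andbF // andbT.
by apply: contraTneq Dq => ->; rewrite (disjointFr disjoint_glue) // imset_f.
Qed.

Lemma glueD1r C : C \in q -> glue p q :\ (@rshift n m @: C) = glue p (q :\ C).
Proof.
move=> Cq; apply/setP => D; rewrite !inE andb_orr; congr (_ || _).
  have [Dp|] := boolP (_ \in _); rewrite ?andbF // andbT.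
  by apply: contraTneq Dp => ->; rewrite (disjointFl disjoint_glue) // imset_f.
apply/andP/imsetP => [[DC /imsetP[E Eq e]]|[E]].
  by exists E; rewrite // !inE Eq andbT; apply: contraNneq DC => <-; rewrite e.
by rewrite !inE => /andP[EC Eq] ->; rewrite (inj_eq (imset_inj rI)) EC imset_f.
Qed.

End Glue.

Lemma sum_glue_paths (V : nmodType) (n m : nat) (F : {set {set 'I_n}} -> {set {set 'I_m}} -> V) :
  (\sum_(p | partition p [set: 'I_n]) \sum_(q | partition q [set: 'I_m]) F p q =
   \sum_(Sp : int_path n | is_Spath Sp) \sum_(Sm : int_path m | is_Spath Sm)
     \sum_(p in partitions_of_path Sp) \sum_(q in partitions_of_path Sm) F p q)%R.
Proof.
rewrite big_partition_path; apply: eq_bigr => Sp _.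
by rewrite [RHS]exchange_big /=; apply: eq_bigr => p _; exact: big_partition_path.
Qed.

Lemma Mlist_gt0 n (S : int_path n) a b : all (leq 1) (Mlist a b S).
Proof.
apply/allP => x /mapP[j]; rewrite mem_filter => /andP[jj _] ->.
by rewrite subn_gt0.
Qed.

(** Here c C stands for the integral attached to a cell C, h C for the one
    attached to C together with the new point, and h0 for the integral attached
    to the new point alone; u, U and l, L express c and h on either side through
    the maximal index and the size of the cell. *)
Section PathSums.
Variables (R : fieldType) (chi : seq nat -> R).
Local Open Scope ring_scope.
Hypothesis chi_perm : forall e e', all (leq 1%N) e -> perm_eq e e' -> chi e = chi e'.
Hypothesis chi_new : forall e, all (leq 1%N) e -> chi e = 0 -> chi (1%N :: e) = 0.
Hypothesis chi_grow : forall k e, all (leq 1%N) e -> chi (k.+1 :: e) = 0 ->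
  chi (k.+2 :: e) = 0.

Variables (n m : nat).
Variables (c h : {set 'I_(n + m)} -> R) (h0 : R).
Variables (u U l L : nat -> nat -> R).
Hypothesis c_l : forall C : {set 'I_n}, C != set0 ->
  c (@lshift n m @: C) = u (cell_top C).+1 #|C|.
Hypothesis c_r : forall C : {set 'I_m}, C != set0 ->
  c (@rshift n m @: C) = l (cell_top C).+1 #|C|.
Hypothesis h_l : forall C : {set 'I_n}, C != set0 ->
  h (@lshift n m @: C) = U (cell_top C).+1 #|C|.
Hypothesis h_r : forall C : {set 'I_m}, C != set0 ->
  h (@rshift n m @: C) = L (cell_top C).+1 #|C|.
Hypothesis c_straddles : forall C, straddles C -> c C = 0.
Hypothesis h_straddles : forall C, straddles C -> h C = 0.
Hypothesis uU : forall C : {set 'I_n}, C != set0 ->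
  u (cell_top C).+1 #|C| = 0 -> U (cell_top C).+1 #|C| = 0.
Hypothesis lL : forall C : {set 'I_m}, C != set0 ->
  l (cell_top C).+1 #|C| = 0 -> L (cell_top C).+1 #|C| = 0.

Local Notation Mp Sp := (Mlist 1 n Sp).
Local Notation Mm Sm := (Mlist 1 m Sm).

Definition path_weight (Sp : int_path n) (Sm : int_path m) : R :=
  chi (Mp Sp ++ Mm Sm)
  * (\prod_(1 <= j < n.+1 | jump Sp j) u j (incr Sp j)
     * \prod_(1 <= j < m.+1 | jump Sm j) l j (incr Sm j)).

Definition path_prediction (Sp : int_path n) (Sm : int_path m) : R :=
  chi (Mp Sp ++ Mm Sm ++ [:: 1%N]) / chi (Mp Sp ++ Mm Sm) * h0
  + \sum_(1 <= j < n.+1 | jump Sp j)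
      chi (rem (incr Sp j) (Mp Sp) ++ Mm Sm ++ [:: (incr Sp j).+1])
      / chi (Mp Sp ++ Mm Sm) * (U j (incr Sp j) / u j (incr Sp j))
  + \sum_(1 <= j < m.+1 | jump Sm j)
      chi (Mp Sp ++ rem (incr Sm j) (Mm Sm) ++ [:: (incr Sm j).+1])
      / chi (Mp Sp ++ Mm Sm) * (L j (incr Sm j) / l j (incr Sm j)).

Lemma glue_weight Sp Sm p q :
  partition p [set: 'I_n] -> partition q [set: 'I_m] ->
  p \in partitions_of_path Sp -> q \in partitions_of_path Sm ->
  chi (cell_sizes (glue p q)) * \prod_(C in glue p q) c C = path_weight Sp Sm.
Proof.
move=> hp hq pS qS; have [_ _ p0] := and3P hp.
rewrite big_glue //= /path_weight; congr (_ * (_ * _)).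
- apply/esym/chi_perm; first by rewrite all_cat !Mlist_gt0.
  rewrite perm_sym; apply: perm_trans (cell_sizes_glue _ p0) _.
  by apply: perm_cat; rewrite perm_sym; exact: perm_Mlist.
- rewrite -(big_cell_tops hp _ u pS); apply: eq_bigr => C Cp.
  by rewrite c_l // (partition_neq0 hp).
- rewrite -(big_cell_tops hq _ l qS); apply: eq_bigr => C Cq.
  by rewrite c_r // (partition_neq0 hq).
Qed.

(** The denominators cancel even where they vanish, since then the numerators
    that they are paired with vanish too. *)
Let mulf_cancel0 (x x' v V a b : R) : (x = 0 -> x' = 0) -> (v = 0 -> V = 0) ->
  x' / x * (V / v) * (x * (v * a * b)) = x' * V * (a * b).
Proof.
move=> xx' vV; have [x0|x0] := eqVneq x 0; first by rewrite (xx' x0) !mul0r.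
have [v0|v0] := eqVneq v 0; first by rewrite (vV v0) !(mulr0, mul0r).
by field; rewrite x0 v0.
Qed.

(** The contribution of one pair of partitions to the numerator of Bayes' formula:
    the three terms of the prediction correspond to a new point that is alone,
    joins a positive cell, or joins a negative cell. *)
Lemma glue_prediction Sp Sm p q :
  partition p [set: 'I_n] -> partition q [set: 'I_m] ->
  p \in partitions_of_path Sp -> q \in partitions_of_path Sm ->
  chi (1%N :: cell_sizes (glue p q)) * h0 * \prod_(C in glue p q) c C
  + \sum_(C in glue p q) chi (#|C|.+1 :: cell_sizes (glue p q :\ C)) * h C
      * \prod_(D in glue p q :\ C) c D =
  path_prediction Sp Sm * path_weight Sp Sm.
Proof.
move=> hp hq pS qS; have [_ _ p0] := and3P hp.
have p_neq0 := partition_neq0 hp; have q_neq0 := partition_neq0 hq.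
have pM := perm_Mlist hp pS; have qM := perm_Mlist hq qS.
have M1 : all (leq 1%N) (Mp Sp ++ Mm Sm) by rewrite all_cat !Mlist_gt0.
have pe : perm_eq (Mp Sp ++ Mm Sm) (cell_sizes p ++ cell_sizes q) by exact: perm_cat.
have pr : \prod_(C in p) c (@lshift n m @: C) =
    \prod_(1 <= j < n.+1 | jump Sp j) u j (incr Sp j).
  rewrite -(big_cell_tops hp _ u pS); apply: eq_bigr => C Cp.
  by rewrite c_l // p_neq0.
have qr : \prod_(C in q) c (@rshift n m @: C) =
    \prod_(1 <= j < m.+1 | jump Sm j) l j (incr Sm j).
  rewrite -(big_cell_tops hq _ l qS); apply: eq_bigr => C Cq.
  by rewrite c_r // q_neq0.
rewrite /path_prediction !mulrDl [X in _ + X = _]big_glue //= addrA; congr (_ + _ + _).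
- have e : chi (1%N :: cell_sizes (glue p q)) = chi (Mp Sp ++ Mm Sm ++ [:: 1%N]).
    apply/esym/chi_perm; first by rewrite catA all_cat M1.
    rewrite catA perm_catC /= perm_cons (perm_trans pe) // perm_sym.
    exact: cell_sizes_glue.
  rewrite e big_glue //= /path_weight pr qr.
  have [M0|M0] := eqVneq (chi (Mp Sp ++ Mm Sm)) 0; last by field.
  rewrite (_ : chi (_ ++ _ ++ [:: 1%N]) = 0) ?mul0r //.
  rewrite -(chi_new M1 M0); apply: chi_perm; first by rewrite catA all_cat M1.
  by rewrite catA perm_catC.
- rewrite -(big_cell_tops hp _ (fun j k =>
    chi (rem k (Mp Sp) ++ Mm Sm ++ [:: k.+1]) / chi (Mp Sp ++ Mm Sm) * (U j k / u j k)) pS).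
  rewrite mulr_suml; apply: eq_bigr => C Cp.
  have C0 := p_neq0 _ Cp.
  have Cc : #|C| != 0%N by rewrite -lt0n card_gt0.
  have pD0 : set0 \notin p :\ C by apply: contra p0; rewrite !inE => /andP[].
  have CM : #|C| \in Mp Sp by rewrite (perm_mem pM) map_f ?mem_enum.
  have prem : perm_eq (rem #|C| (Mp Sp)) (cell_sizes (p :\ C)).
    rewrite -(perm_cons #|C|) perm_sym (perm_trans (cell_sizes_setD1 Cp)) // perm_sym.
    by rewrite (perm_trans _ pM) // perm_sym perm_to_rem.
  have r1 : all (leq 1%N) (rem #|C| (Mp Sp) ++ Mm Sm).
    by move: M1; rewrite !all_cat (perm_all _ (perm_to_rem CM)) /= -andbA => /and3P[_ -> ->].
  have pg : perm_eq (rem #|C| (Mp Sp) ++ Mm Sm ++ [:: #|C|.+1])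
      (#|C|.+1 :: cell_sizes (glue (p :\ C) q)).
    rewrite catA perm_catC /= perm_cons perm_sym.
    apply: perm_trans (cell_sizes_glue _ pD0) _.
    by rewrite perm_sym; exact: perm_cat.
  rewrite glueD1l // card_imset; last exact: lshift_inj.
  rewrite -(chi_perm _ pg); last by rewrite catA all_cat r1.
  rewrite h_l // big_glue //= /path_weight -pr -qr (big_setD1 _ Cp) /= c_l //.
  rewrite mulf_cancel0 //; last exact: uU.
  move=> M0; rewrite -(@chi_grow #|C|.-1 (rem #|C| (Mp Sp) ++ Mm Sm)) //.
  + rewrite prednK ?lt0n //; apply: chi_perm; first by rewrite catA all_cat r1.
    by rewrite catA perm_catC.
  + rewrite prednK ?lt0n // -M0; apply: chi_perm; first by rewrite /= r1 lt0n Cc.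
    by rewrite -cat_cons perm_cat // perm_sym perm_to_rem.
- rewrite -(big_cell_tops hq _ (fun j k =>
    chi (Mp Sp ++ rem k (Mm Sm) ++ [:: k.+1]) / chi (Mp Sp ++ Mm Sm) * (L j k / l j k)) qS).
  rewrite mulr_suml; apply: eq_bigr => C Cq.
  have C0 := q_neq0 _ Cq.
  have Cc : #|C| != 0%N by rewrite -lt0n card_gt0.
  have CM : #|C| \in Mm Sm by rewrite (perm_mem qM) map_f ?mem_enum.
  have prem : perm_eq (rem #|C| (Mm Sm)) (cell_sizes (q :\ C)).
    rewrite -(perm_cons #|C|) perm_sym (perm_trans (cell_sizes_setD1 Cq)) // perm_sym.
    by rewrite (perm_trans _ qM) // perm_sym perm_to_rem.
  have r1 : all (leq 1%N) (Mp Sp ++ rem #|C| (Mm Sm)).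
    move: M1; rewrite !all_cat (perm_all _ (perm_to_rem CM)) /=.
    by move=> /and3P[-> _ ->].
  have pg : perm_eq (Mp Sp ++ rem #|C| (Mm Sm) ++ [:: #|C|.+1])
      (#|C|.+1 :: cell_sizes (glue p (q :\ C))).
    rewrite catA perm_catC /= perm_cons perm_sym.
    apply: perm_trans (cell_sizes_glue _ p0) _.
    by rewrite perm_sym; exact: perm_cat.
  rewrite glueD1r // card_imset; last exact: rshift_inj.
  rewrite -(chi_perm _ pg); last by rewrite catA all_cat r1.
  rewrite h_r // big_glue //= /path_weight -pr -qr (big_setD1 _ Cq) /= c_r //.
  rewrite [X in _ = _ * (_ * X)]mulrC mulf_cancel0; last exact: lL.
    by congr (_ * _); rewrite mulrC.
  move=> M0; rewrite -(@chi_grow #|C|.-1 (Mp Sp ++ rem #|C| (Mm Sm))) //.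
  + rewrite prednK ?lt0n //; apply: chi_perm; first by rewrite catA all_cat r1.
    by rewrite catA perm_catC.
  + rewrite prednK ?lt0n // -M0; apply: chi_perm; first by rewrite /= r1 lt0n Cc.
    rewrite -cat_cons -cat1s -catA perm_catCA perm_cat2l cat1s.
    by rewrite perm_sym perm_to_rem.
Qed.

Lemma sum_const_fibers (Sp : int_path n) (Sm : int_path m) (F : _ -> _ -> R) v :
  (forall p q, p \in partitions_of_path Sp -> q \in partitions_of_path Sm -> F p q = v) ->
  \sum_(p in partitions_of_path Sp) \sum_(q in partitions_of_path Sm) F p q =
  v * (#|partitions_of_path Sp|%:R * #|partitions_of_path Sm|%:R).
Proof.
move=> Fv; rewrite (eq_bigr (fun=> v *+ #|partitions_of_path Sm|)) => [|p pS].
  by rewrite sumr_const -mulrnA mulnC -natrM mulr_natr.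
by rewrite (eq_bigr (fun=> v)) ?sumr_const // => q qS; exact: Fv.
Qed.

Lemma sum_partition_weight :
  \sum_(p | partition p [set: 'I_(n + m)]) chi (cell_sizes p) * \prod_(C in p) c C =
  \sum_(Sp : int_path n | is_Spath Sp) \sum_(Sm : int_path m | is_Spath Sm)
    path_weight Sp Sm * (#|partitions_of_path Sp|%:R * #|partitions_of_path Sm|%:R).
Proof.
rewrite sum_partition_glue; last first.
  by move=> p C _ Cp sC; rewrite (bigD1 C) //= c_straddles // mul0r mulr0.
rewrite sum_glue_paths; apply: eq_bigr => Sp _; apply: eq_bigr => Sm _.
apply: sum_const_fibers => p q pS qS.
by apply: glue_weight => //; [move: pS | move: qS]; rewrite inE => /andP[].
Qed.

Lemma sum_partition_prediction :
  \sum_(p | partition p [set: 'I_(n + m)])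
    (chi (1%N :: cell_sizes p) * h0 * \prod_(C in p) c C
     + \sum_(C in p) chi (#|C|.+1 :: cell_sizes (p :\ C)) * h C
         * \prod_(D in p :\ C) c D) =
  \sum_(Sp : int_path n | is_Spath Sp) \sum_(Sm : int_path m | is_Spath Sm)
    path_prediction Sp Sm * path_weight Sp Sm
    * (#|partitions_of_path Sp|%:R * #|partitions_of_path Sm|%:R).
Proof.
rewrite sum_partition_glue; last first.
  move=> p C _ Cp sC; rewrite (bigD1 C Cp) /= c_straddles // mul0r mulr0 add0r.
  apply: big1 => D Dp; have [<-|CD] := eqVneq C D.
    by rewrite h_straddles // mulr0 mul0r.
  by rewrite (bigD1 C) /= ?c_straddles ?mul0r ?mulr0 // !inE CD.
rewrite sum_glue_paths; apply: eq_bigr => Sp _; apply: eq_bigr => Sm _.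
apply: sum_const_fibers => p q pS qS.
by apply: glue_prediction => //; [move: pS | move: qS]; rewrite inE => /andP[].
Qed.

End PathSums.

From mathcomp Require Import all_classical all_reals all_analysis.
From mathcomp Require Import measurable_realfun.
Import numFieldNormedType.Exports.

Local Open Scope classical_set_scope.
Local Open Scope ring_scope.

(** * Integrals of nonnegative functions *)

Section IntegralTools.
Context (d : measure_display) (T : measurableType d) (R : realType).
Variable mu : {measure set T -> \bar R}.
Import HBNNSimple.

(** For possibly nonmeasurable f and g: a simple function below f, set to 0 on the
    null set where f and g differ, is below g and has the same integral. This
    form applies directly to functions of w defined through G w. *)
Lemma ae_eq_ge0_integral (f g : T -> \bar R) :
  (forall x, 0 <= f x)%E -> (forall x, 0 <= g x)%E ->
  {ae mu, forall x, f x = g x} -> (\int[mu]_x f x = \int[mu]_x g x)%E.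
Proof.
move=> f0 g0 [N [mN muN fgN]].
suff le (u v : T -> \bar R) : (forall x, 0 <= u x)%E -> (forall x, 0 <= v x)%E ->
    (forall x, ~ N x -> u x = v x) -> (\int[mu]_x u x <= \int[mu]_x v x)%E.
  have fg x : ~ N x -> f x = g x by move=> Nx; apply: contrapT => /fgN.
  by apply/eqP; rewrite eq_le !le // => x /fg.
move=> u0 v0 uv; rewrite !ge0_integralTE //.
apply: ge_ereal_sup => _ [h /= hu] <-.
have mN' : measurable (~` N) by exact: measurableC.
apply: ereal_sup_ubound; exists (proj_nnsfun h mN').
  move=> x; rewrite -mrestrict /patch; case: ifPn => [|_]; last exact: v0.
  by rewrite inE => Nx; rewrite -uv.
rewrite -!integralT_nnsfun [RHS](@ge0_negligible_integral _ _ _ mu setT N) //; last 2 first.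
- exact/measurable_EFinP.
- by move=> x _; rewrite lee_fin.
rewrite setTD [RHS]integral_mkcond -mrestrict restrict_EFin.
exact: eq_integral.
Qed.

(** From sets to functions: if the law of X under the measure with density Z is
    c times nu on measurable sets, then it is so on nonnegative functions. With
    one variable freed at a time, this turns product rules for events into
    product rules for expectations. *)
Lemma ge0_integral_weighted_comp (d' : measure_display) (T' : measurableType d')
    (X : T -> T') (Z : T -> R) (nu : {measure set T' -> \bar R}) (c : R) :
  measurable_fun setT X -> measurable_fun setT Z -> (forall x, 0 <= Z x) -> 0 <= c ->
  (forall A, measurable A -> (\int[mu]_x (Z x * \1_A (X x))%:E = c%:E * nu A)%E) ->
  forall g : T' -> R, measurable_fun setT g -> (forall x, 0 <= g x) ->
  (\int[mu]_x (Z x * g (X x))%:E = c%:E * \int[nu]_x (g x)%:E)%E.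
Proof.
move=> mX mZ Z0 c0 h g mg g0.
have mg' : measurable_fun setT (EFin \o g) by exact/measurable_EFinP.
pose a := nnsfun_approx measurableT mg'.
have acvg x : a n x @[n --> \oo] --> g x.
  have := @cvg_nnsfun_approx _ _ _ _ measurableT _ mg' _ x Logic.I.
  by move=> /(_ (fun y _ => g0 y)) /fine_cvgP[].
(* The identity for the simple functions that increase to g. *)
have ha n : (\int[mu]_x (Z x * a n (X x))%:E = c%:E * \int[nu]_x (a n x)%:E)%E.
  have mA y : measurable (a n @^-1` [set y]) by exact: measurable_funPTI.
  have fE x : (a n x)%:E = (\sum_(y \in range (a n)) (y * \1_(a n @^-1` [set y]) x)%:E)%E.
    by rewrite fimfunE -fsumEFin.
  under [in RHS]eq_integral do rewrite fE.
  rewrite [in RHS]ge0_integral_fsum; first last.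
  - by [].
  - by move=> r t _; rewrite EFinM nnfun_muleindic_ge0.
  - move=> y; apply/measurable_EFinP; apply: measurable_funM => //.
  - by [].
  transitivity (c%:E * \sum_(y \in range (a n)) y%:E * nu (a n @^-1` [set y]))%E; last first.
    congr (_ * _)%E; apply: eq_fsbigr => y _.
    by rewrite integralZl_indic_nnsfun // integral_indic // setIT.
  have mX1 y : measurable_fun setT (fun x => \1_(a n @^-1` [set y]) (X x) : R).
    by apply: measurableT_comp => //; exact: measurable_indic.
  transitivity (\int[mu]_x (\sum_(y \in range (a n)) y%:E * (Z x * \1_(a n @^-1` [set y]) (X x))%:E))%E.
    apply: eq_integral => x _; rewrite EFinM fE ge0_mule_fsumr; last by move=> y; rewrite EFinM nnfun_muleindic_ge0.
    by apply: eq_fsbigr => y _; rewrite -!EFinM mulrCA.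
  rewrite ge0_integral_fsum //; last 2 first.
  - by move=> y; apply: emeasurable_funM => //; apply/measurable_EFinP; exact: measurable_funM.
  - move=> y x _; rewrite EFinM muleCA; apply: mule_ge0; first by rewrite lee_fin.
    by rewrite nnfun_muleindic_ge0.
  rewrite ge0_mule_fsumr; last by move=> y; exact: nnsfun_mulemu_ge0.
  apply: eq_fsbigr => y; rewrite inE => -[x _ <-].
  rewrite ge0_integralZl_EFin //; first by rewrite h // muleCA.
  - by move=> z _; rewrite lee_fin mulr_ge0.
  - by apply/measurable_EFinP; exact: measurable_funM.
have acvg' : (fun n => \int[nu]_x (a n x)%:E)%E @ \oo --> (\int[nu]_x (g x)%:E)%E.
  have -> : (\int[nu]_x (g x)%:E = \int[nu]_x limn (fun n => (a n x)%:E))%E.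
    apply: eq_integral => x _; apply/esym/cvg_lim => //.
    by apply: cvg_EFin; [near=> n | exact: acvg].
  apply: cvg_monotone_convergence => //.
  - by move=> n; apply/measurable_EFinP.
  - by move=> n x _; rewrite lee_fin.
  - by move=> x _ m n mn; rewrite lee_fin; have /lefP := nd_nnsfun_approx measurableT mg' mn; apply.
rewrite -(cvg_lim _ (cvgeZl _ acvg')) //.
under [in RHS]eq_fun do rewrite -ha.
rewrite -monotone_convergence //; last 3 first.
- move=> n; apply/measurable_EFinP; apply: measurable_funM => //.
  exact: measurableT_comp.
- by move=> n x _; rewrite lee_fin mulr_ge0.
- move=> x _ m n mn; rewrite lee_fin ler_wpM2l //.
  by have /lefP := nd_nnsfun_approx measurableT mg' mn; apply.
apply: eq_integral => x _; apply/esym/cvg_lim => //.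
apply: cvg_EFin; first by near=> n.
by apply: cvgM; [exact: cvg_cst | exact: acvg].
Unshelve. all: by end_near. Qed.
End IntegralTools.

(** * Independence *)

Section Independence.
Context (d : measure_display) (T : measurableType d) (R : realType).
Variable P : probability T R.

(** The weighted comparison is used twice, first with the weight 1_B(Y) to replace
    the event on Z by Z itself, then with the weight Z. *)
Lemma ge0_integral_indep (Z Y : T -> R) :
  measurable_fun setT Z -> measurable_fun setT Y ->
  (forall x, 0 <= Z x <= 1) -> (forall x, 0 <= Y x) ->
  (forall A B, measurable A -> measurable B ->
     P ((Z @^-1` A) `&` (Y @^-1` B)) = (P (Z @^-1` A) * P (Y @^-1` B))%E) ->
  (\int[P]_x (Z x * Y x)%:E = (\int[P]_x (Z x)%:E) * (\int[P]_x (Y x)%:E))%E.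
Proof.
move=> mZ mY Z01 Y0 ind.
have Z0 x : 0 <= Z x by case/andP: (Z01 x).
pose Zm : {mfun T >-> R} := HB.pack Z (isMeasurableFun.Build _ _ _ _ _ mZ).
pose Ym : {mfun T >-> R} := HB.pack Y (isMeasurableFun.Build _ _ _ _ _ mY).
have Zfin : (\int[P]_x (Z x)%:E \is a fin_num)%E.
  rewrite ge0_fin_numE; last by apply: integral_ge0 => x _; rewrite lee_fin.
  apply: (@le_lt_trans _ _ (\int[P]_x (cst 1 x))%E); last first.
    rewrite integral_cst // mul1e.
    exact: le_lt_trans (probability_le1 P measurableT) (ltry _).
  apply: ge0_le_integral => //.
  - by move=> x _; rewrite lee_fin.
  - exact/measurable_EFinP.
  - by move=> x _; rewrite lee_fin; case/andP: (Z01 x).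
have step1 B : measurable B ->
    (\int[P]_x (\1_B (Y x) * Z x)%:E = P (Y @^-1` B) * \int[P]_x (Z x)%:E)%E.
  move=> mB.
  have mYB : measurable (Y @^-1` B) by rewrite -[X in measurable X]setTI; exact (mY measurableT _ mB).
  have finYB := fin_num_measure P _ mYB.
  (* The identity function is replaced by r |-> max r 0, which is nonnegative
     everywhere and agrees with it on the range of Z. *)
  have -> : (\int[P]_x (Z x)%:E = \int[distribution P Zm]_r (Num.max r 0)%:E)%E.
    rewrite ge0_integral_distribution //=.
    - by apply: eq_integral => x _ /=; rewrite /Num.max ltNge Z0.
    - by apply/measurable_EFinP; exact: measurable_maxr.
    - by move=> r; rewrite lee_fin le_max lexx orbT.
  rewrite -[P (Y @^-1` B)]fineK //.
  rewrite -(@ge0_integral_weighted_comp _ _ _ P _ _ Z (fun x => \1_B (Y x)) (distribution P Zm)) //.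
  - by apply: eq_integral => x _; rewrite /Num.max ltNge Z0.
  - by apply: measurableT_comp => //; exact: measurable_indic.
  - exact: fine_ge0.
  - move=> A mA; rewrite fineK // muleC -[X in _ = (X * _)%E]/(P (Z @^-1` A)) -ind //.
    transitivity (\int[P]_x (\1_((Z @^-1` A) `&` (Y @^-1` B)) x)%:E)%E.
      by apply: eq_integral => x _; rewrite indicI mulrC.
    rewrite integral_indic ?setIT //; apply: measurableI => //.
    by rewrite -[X in measurable X]setTI; exact (mZ measurableT _ mA).
  - exact: measurable_maxr.
  - by move=> r; rewrite le_max lexx orbT.
have -> : (\int[P]_x (Y x)%:E = \int[distribution P Ym]_r (Num.max r 0)%:E)%E.
  rewrite ge0_integral_distribution //=.
  - by apply: eq_integral => x _ /=; rewrite /Num.max ltNge Y0.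
  - by apply/measurable_EFinP; exact: measurable_maxr.
  - by move=> r; rewrite lee_fin le_max lexx orbT.
rewrite -[X in (X * _)%E](fineK Zfin).
rewrite -(@ge0_integral_weighted_comp _ _ _ P _ _ Y Z (distribution P Ym)) //.
- by apply: eq_integral => x _; rewrite /Num.max ltNge Y0.
- by apply: fine_ge0; apply: integral_ge0 => x _; rewrite lee_fin.
- move=> B mB; rewrite fineK // muleC -step1 //.
  by apply: eq_integral => x _; rewrite mulrC.
- exact: measurable_maxr.
- by move=> r; rewrite le_max lexx orbT.
Qed.

End Independence.

Section IidAtoms.
Context (d : measure_display) (T : measurableType d) (R : realType).
Variables (P : probability T R) (H : probability R R) (K : pred nat).
Variable xi : nat -> {RV P >-> R}.
Hypothesis iid : forall (s : seq nat) (A : nat -> set R),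
    uniq s -> all K s -> (forall k, measurable (A k)) ->
    P (\big[setI/setT]_(k <- s) (xi k @^-1` A k)) = (\prod_(k <- s) H (A k))%E.

(** The factors pass from indicators to functions one after the other; the
    induction keeps a product of functions over s1 and of events over s2. *)
Lemma ge0_integral_prod_iid (s : seq nat) (g : nat -> R -> R) :
  uniq s -> all K s -> (forall k, measurable_fun setT (g k)) ->
  (forall k x, 0 <= g k x) -> (forall k, \int[H]_x (g k x)%:E \is a fin_num)%E ->
  (\int[P]_w (\prod_(k <- s) g k (xi k w))%:E)%E =
  (\prod_(k <- s) \int[H]_x g k x)%:E.
Proof.
move=> us Ks mg g0 gfin.
have mA' A s2 : (forall k, measurable (A k)) ->
    measurable (\big[setI/setT]_(k <- s2) (xi k @^-1` A k)).
  move=> mA; elim: s2 => [|k s2 IH]; first by rewrite big_nil.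
  by rewrite big_cons; apply: measurableI => //; exact: measurable_funPTI.
suff gen s1 s2 (A : nat -> set R) : uniq (s1 ++ s2) -> all K (s1 ++ s2) ->
    (forall k, measurable (A k)) ->
    (\int[P]_w (\prod_(k <- s1) g k (xi k w)
       * \1_(\big[setI/setT]_(k <- s2) (xi k @^-1` A k)) w)%:E)%E =
    ((\prod_(k <- s1) \int[H]_x g k x)%:E * \prod_(k <- s2) H (A k))%E.
  have := gen s [::] (fun=> setT); rewrite cats0 !big_nil mule1 => <- //.
  by apply: eq_integral => w _; rewrite indicE in_setT mulr1.
elim: s1 s2 A => [|k s1 IH] s2 A us' Ks' mA.
  rewrite big_nil mul1e -iid //.
  under eq_integral do rewrite big_nil mul1r.
  rewrite integral_indic ?setIT //; exact: mA'.
have Hprod (s' : seq nat) : (\prod_(k <- s') H (A k))%E = (\prod_(k <- s') fine (H (A k)))%:E.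
  elim: s' => [|j s' IHs]; rewrite ?big_nil // !big_cons EFinM IHs fineK //.
  exact: fin_num_measure.
pose Z w := \prod_(j <- s1) g j (xi j w) * \1_(\big[setI/setT]_(j <- s2) (xi j @^-1` A j)) w.
pose c := (\prod_(j <- s1) \int[H]_x g j x) * \prod_(j <- s2) fine (H (A j)).
have -> : ((\prod_(j <- k :: s1) \int[H]_x g j x)%:E * \prod_(j <- s2) H (A j))%E =
    (c%:E * \int[H]_x (g k x)%:E)%E.
  rewrite Hprod -EFinM big_cons /c [(\int[H]_x g k x)%R]/Rintegral.
  by rewrite -[in RHS](fineK (gfin k)) -EFinM; congr EFin; rewrite -mulrA [LHS]mulrC.
rewrite -(@ge0_integral_weighted_comp _ _ _ P _ _ (xi k) Z) //.
- by apply: eq_integral => w _; rewrite big_cons /Z -mulrA [in LHS]mulrC.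
- apply: measurable_funM; last by apply: measurable_indic; exact: mA'.
  by apply: measurable_prod => j _; apply: measurableT_comp.
- by move=> w; rewrite mulr_ge0 ?indicE //; apply: prodr_ge0.
- rewrite mulr_ge0 //; apply: prodr_ge0 => j _; last exact: fine_ge0.
  by apply: Rintegral_ge0.
move=> B mB.
move: us'; rewrite -cat1s -catA uniq_catCA cat1s => us'.
move: Ks'; rewrite /= all_cat andbCA -[K k && _]/(all K (k :: s2)) -all_cat => Ks'.
have kj j : j \in s2 -> (j == k) = false.
  move: us'; rewrite cat_uniq => /and3P[_ _ /andP[ks2 _]] js.
  by apply: contraNF ks2 => /eqP <-.
have := IH (k :: s2) (fun j => if j == k then B else A j) us' Ks'.
rewrite !big_cons eqxx.
rewrite (_ : \big[setI/setT]_(j <- s2) _ = \big[setI/setT]_(j <- s2) (xi j @^-1` A j)); last first.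
  by apply: eq_big_seq => j /kj ->.
rewrite (_ : (\prod_(j <- s2) H _)%E = (\prod_(j <- s2) H (A j))%E); last first.
  by apply: eq_big_seq => j /kj ->.
rewrite Hprod muleCA -EFinM muleC => <-; last by move=> j; case: eqP.
by apply: eq_integral => w _; rewrite indicI /Z -mulrA; congr ((_ * _)%:E); rewrite mulrC.
Qed.

(** The pair of the two variables has the product law, under which the diagonal
    is null because its sections are points. *)
Lemma iid_nonatomic_neq i j : (forall x, H [set x] = 0%E) ->
  K i -> K j -> i != j -> P [set w | xi i w = xi j w] = 0%E.
Proof.
move=> na Ki Kj ij.
have mX : measurable_fun setT (fun w => (xi i w, xi j w)) by exact: measurable_fun_pair.
pose X : {RV P >-> (R * R)%type} := HB.pack (fun w => (xi i w, xi j w)) (isMeasurableFun.Build _ _ _ _ _ mX).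
have mD : measurable [set u : R * R | u.1 = u.2].
  have := @measurable_fun_eqr _ (R * R)%type R setT fst snd.
  move=> /(_ measurable_fst measurable_snd measurableT [set true]).
  rewrite setTI => h; have -> : [set u : R * R | u.1 = u.2] =
    (fun x : R * R => x.1 == x.2) @^-1` [set true].
    by apply/seteqP; split => u /= /eqP.
  exact: h.
have E := @product_measure_unique _ _ _ _ R H H (distribution P X) _ _ mD.
apply: etrans (esym (E _)) _.
  move=> A B mA mB.
  have := @iid [:: i; j] (fun k => if k == i then A else B).
  rewrite /= inE ij Ki Kj !big_cons !big_nil eqxx eq_sym (negPf ij) setIT mule1.
  by apply => // k; case: eqP.
rewrite /product_measure1 integral0_eq // => x _ /=.
rewrite (_ : xsection _ x = [set x]) ?na //.
by apply/seteqP; split => y; rewrite /xsection /= inE /= => ->.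
Qed.

End IidAtoms.

(** * Series over lists of labels *)

Section LabelSum.
Context {R : realType}.
Local Open Scope ereal_scope.

(** An iterated series rather than a sum over the countable set of lists, so that
    its properties follow from those of series by induction on n. *)
Fixpoint label_sum (n : nat) (F : seq nat -> \bar R) : \bar R :=
  if n is m.+1 then \sum_(0 <= l <oo) label_sum m (fun b => F (l :: b)) else F [::].

Lemma label_sum_ge0 n (F : seq nat -> \bar R) :
  (forall b, 0 <= F b) -> 0 <= label_sum n F.
Proof.
elim: n F => [|n IH] F F0 /=; first exact: F0.
by apply: nneseries_ge0 => l _ _; apply: IH => b.
Qed.

Lemma eq_label_sum n (F F' : seq nat -> \bar R) :
  (forall b, size b = n -> F b = F' b) -> label_sum n F = label_sum n F'.
Proof.
elim: n F F' => [|n IH] F F' FF' /=; first exact: FF'.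
by apply: eq_eseriesr => l _; apply: IH => b bn; apply: FF'; rewrite /= bn.
Qed.

Lemma le_label_sum n (F F' : seq nat -> \bar R) :
  (forall b, 0 <= F b) -> (forall b, size b = n -> F b <= F' b) ->
  label_sum n F <= label_sum n F'.
Proof.
elim: n F F' => [|n IH] F F' F0 FF' /=; first exact: FF'.
apply: lee_nneseries => l *; first exact: label_sum_ge0.
by apply: IH => // b bn; apply: FF'; rewrite /= bn.
Qed.

Lemma label_sumZl n (F : seq nat -> \bar R) (c : R) :
  (0 <= c)%R -> (forall b, 0 <= F b) ->
  label_sum n (fun b => c%:E * F b) = c%:E * label_sum n F.
Proof.
move=> c0; elim: n F => [|n IH] F F0 //=.
rewrite -nneseriesZl; last by move=> l _; apply: label_sum_ge0.
by apply: eq_eseriesr => l _; apply: IH.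
Qed.

Lemma label_sum_sum n (I : Type) (s : seq I) (Q : pred I) (F : I -> seq nat -> \bar R) :
  (forall i b, 0 <= F i b) ->
  label_sum n (fun b => \sum_(i <- s | Q i) F i b) = \sum_(i <- s | Q i) label_sum n (F i).
Proof.
elim: n F => [|n IH] F F0 //=.
rewrite -nneseries_sum; last by move=> i l _; apply: label_sum_ge0.
by apply: eq_eseriesr => l _; apply: IH.
Qed.

Lemma label_sum_series n (F : nat -> seq nat -> \bar R) :
  (forall l b, 0 <= F l b) ->
  \sum_(0 <= l <oo) label_sum n (F l) = label_sum n (fun b => \sum_(0 <= l <oo) F l b).
Proof.
elim: n F => [|n IH] F F0 //=.
rewrite nneseries_interchange; last by move=> i j; apply: label_sum_ge0.
by apply: eq_eseriesr => l _; apply: IH.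
Qed.

Lemma measurable_label_sum d (T : measurableType d) n (F : T -> seq nat -> \bar R) :
  (forall x b, 0 <= F x b) -> (forall b, measurable_fun setT (F ^~ b)) ->
  measurable_fun setT (fun x => label_sum n (F x)).
Proof.
elim: n F => [|n IH] F F0 mF /=; first exact: mF.
apply: (@ge0_emeasurable_sum _ _ _ setT (fun l x => label_sum n (fun b => F x (l :: b))) xpredT).
  by move=> l x _ _; exact: label_sum_ge0.
by move=> l _; apply: (IH (fun x b => F x (l :: b))) => // b; exact: mF.
Qed.

Lemma integral_label_sum d (T : measurableType d) (mu : {measure set T -> \bar R})
    n (F : T -> seq nat -> \bar R) :
  (forall x b, 0 <= F x b) -> (forall b, measurable_fun setT (F ^~ b)) ->
  \int[mu]_x label_sum n (F x) = label_sum n (fun b => \int[mu]_x F x b).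
Proof.
elim: n F => [|n IH] F F0 mF //=.
rewrite integral_nneseries //.
- by apply: eq_eseriesr => l _; apply: (IH (fun x b => F x (l :: b))).
- by move=> l; apply: (@measurable_label_sum _ _ n (fun x b => F x (l :: b))).
- by move=> l x _; exact: label_sum_ge0.
Qed.

End LabelSum.

(** * Samples from a mixture of atoms and a diffuse law *)

Section MixedMeasure.
Context {R : realType}.
Variables (mu : {measure set R -> \bar R}) (H : probability R R).
Variables (c : nat -> R) (z : nat -> R).
Hypothesis c0 : forall l, 0 <= c l.

Definition label_measure (l : nat) : {measure set R -> \bar R} :=
  if l is k.+1 then \d_(z k) else H.

Hypothesis muE : forall A, measurable A ->
  (mu A = \sum_(0 <= l <oo) (c l)%:E * label_measure l A)%E.

Definition label_integral (f : R -> \bar R) (l : nat) : \bar R :=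
  if l is k.+1 then f (z k) else (\int[H]_x f x)%E.

Lemma ge0_integral_mixed (f : R -> \bar R) :
  measurable_fun setT f -> (forall x, 0 <= f x)%E ->
  (\int[mu]_x f x = \sum_(0 <= l <oo) (c l)%:E * label_integral f l)%E.
Proof.
move=> mf f0.
pose m l : {measure set R -> \bar R} := mscale (NngNum (c0 l)) (label_measure l).
rewrite (@eq_measure_integral _ _ _ setT (mseries m 0)) => [|A mA _]; last exact: muE.
rewrite ge0_integral_measure_series //; apply: eq_eseriesr => l _.
rewrite ge0_integral_mscale //; congr (_ * _)%E.
by case: l => [|k] //=; rewrite integral_dirac // diracT mul1e.
Qed.

End MixedMeasure.

Section MixedSamples.
Context {R : realType}.
Variables (mu : {measure set R -> \bar R}) (H : probability R R).
Variables (c : nat -> R) (z : nat -> R).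
Hypothesis c0 : forall l, 0 <= c l.
Hypothesis muE : forall A, measurable A ->
  (mu A = \sum_(0 <= l <oo) (c l)%:E * label_measure H z l A)%E.

Definition label_mean (f : R -> R) (l : nat) : R :=
  if l is k.+1 then f (z k) else \int[H]_x f x.

Lemma label_mean_ge0 f l : (forall x, 0 <= f x) -> 0 <= label_mean f l.
Proof. by move=> f0; case: l => [|l] //=; apply: Rintegral_ge0. Qed.

Lemma prod_integral_mixed (n : nat) (k : nat -> R -> R) :
  (forall i, measurable_fun setT (k i)) -> (forall i x, 0 <= k i x) ->
  (forall i, \int[H]_x (k i x)%:E \is a fin_num)%E ->
  (forall i, \int[mu]_x (k i x)%:E \is a fin_num)%E ->
  (\prod_(i < n) \int[mu]_x k i x)%:E =
  label_sum n (fun b => (\prod_(l <- b) c l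
                         * \prod_(i < n) label_mean (k i) (nth 0%N b i))%:E).
Proof.
elim: n k => [|n IH] k mk k0 kH kmu; first by rewrite /= !big_ord0 big_nil mulr1.
rewrite big_ord_recl EFinM muleC /Rintegral fineK // (ge0_integral_mixed c0 muE); last 2 first.
- exact/measurable_EFinP.
- by move=> x; rewrite lee_fin.
rewrite -nneseriesZl; last first.
  move=> l _; rewrite mule_ge0 ?lee_fin //; case: l => [|l] /=; rewrite ?lee_fin //.
  by apply: integral_ge0 => x _; rewrite lee_fin.
rewrite (IH (fun i => k i.+1)) //=; apply: eq_eseriesr => l _.
have -> : label_integral H z (EFin \o k 0%N) l = (label_mean (k 0%N) l)%:E.
  by case: l => [|l] //=; rewrite /Rintegral fineK.
rewrite muleC -EFinM -label_sumZl; last 2 first.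
- by rewrite mulr_ge0 // label_mean_ge0.
- move=> b; rewrite lee_fin mulr_ge0 //; apply: prodr_ge0 => // i _.
  exact: label_mean_ge0.
apply: eq_label_sum => b _; rewrite big_cons big_ord_recl /= -EFinM.
by rewrite -!mulrA; congr ((_ * _)%:E); rewrite mulrCA.
Qed.

Definition same_value (x : seq R) (i j : nat) : bool := nth 0 x i == nth 0 x j.

(** Two different points coincide when they come from the same atom; points with
    label 0 come from the diffuse part and never coincide. *)
Definition same_label (b : seq nat) (i j : nat) : bool :=
  (i == j) || (nth 0%N b i == nth 0%N b j) && (nth 0%N b i != 0%N).

Definition agree (n : nat) (e r : rel nat) : bool :=
  [forall i : 'I_n, forall j : 'I_n, e i j == r i j].

Lemma eq_agree n (e e' r : rel nat) :
  (forall i j, (i < n)%N -> (j < n)%N -> e i j = e' i j) -> agree n e r = agree n e' r.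
Proof.
by move=> h; apply: eq_forallb => i; apply: eq_forallb => j; rewrite h.
Qed.

Hypothesis H0 : forall x, H [set x] = 0%E.
Hypothesis z_inj : forall k k', c k.+1 != 0 -> c k'.+1 != 0 -> z k = z k' -> k = k'.

(** The invariant of the induction on the sample: labels and points have the same
    coincidences, and the label k + 1 marks the points that sit on the atom z k. *)
Definition labelled (x : seq R) (a : seq nat) : Prop :=
  [/\ size x = size a,
      forall i j, (i < size a)%N -> (j < size a)%N -> same_value x i j = same_label a i j
    & forall i k, (i < size a)%N -> c k.+1 != 0 -> (nth 0 x i == z k) = (nth 0%N a i == k.+1)].

Lemma labelled_rcons x a y l : labelled x a ->
  (forall i, (i < size a)%N ->
     (nth 0 x i == y) = (nth 0%N a i == l) && (l != 0%N)) ->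
  (forall k, c k.+1 != 0 -> (y == z k) = (l == k.+1)) ->
  labelled (rcons x y) (rcons a l).
Proof.
move=> [sx xa az] xy yz; split.
- by rewrite !size_rcons sx.
- move=> i j; rewrite size_rcons !ltnS => ia ja.
  rewrite /same_value /same_label !nth_rcons sx.
  move: ia ja; rewrite leq_eqVlt => /predU1P[->|ia];
    rewrite leq_eqVlt => /predU1P[->|ja].
  + by rewrite ltnn !eqxx.
  + by rewrite ja ltnn !eqxx (gtn_eqF ja) /= eq_sym xy // eq_sym.
  + rewrite ia ltnn !eqxx (ltn_eqF ia) /= xy //.
    by case: eqP => //= ->.
  + by rewrite ia ja; have := xa _ _ ia ja.
- move=> i k; rewrite size_rcons ltnS leq_eqVlt !nth_rcons sx => /predU1P[->|ia] ck.
    by rewrite ltnn eqxx yz.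
  by rewrite ia az.
Qed.

Lemma iid_law_ge0 (n : nat) (A : set (n.-tuple R)) : (0 <= iid_law mu A)%E.
Proof.
elim: n A => [|n IH] A /=; first by rewrite lee_fin indicE.
by apply: integral_ge0 => x _; exact: IH.
Qed.

(** Sampling one more point given a labelled prefix: from the atom z k it gets the
    label k + 1; from the diffuse part it almost surely avoids the atoms and the
    previous points, and it gets the label 0. *)
Lemma iid_law_labelled (n : nat) (x : seq R) (a : seq nat) (r : rel nat) :
  labelled x a ->
  iid_law mu [set y : n.-tuple R | agree (size a + n) (same_value (x ++ y)) r] =
  label_sum n (fun b => (\prod_(l <- b) c l
                         * (agree (size a + n) (same_label (a ++ b)) r)%:R)%:E).
Proof.
elim: n x a => [|n IH] x a xa.
  rewrite /= big_nil mul1r !cats0 indicE; case: (xa) => _ xa' _.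
  have e : agree (size a + 0) (same_value x) r = agree (size a + 0) (same_label a) r.
    by apply: eq_agree => i j; rewrite addn0; exact: xa'.
  rewrite -e (_ : (_ \in _) = agree (size a + 0) (same_value x) r) //.
  by apply/idP/idP; rewrite inE /= cats0.
have [sx xa' az] := xa.
pose L l := label_sum n (fun b => (\prod_(l <- b) c l
    * (agree (size (rcons a l) + n) (same_label (rcons a l ++ b)) r)%:R)%:E).
have L0 l : (0 <= L l)%E.
  by apply: label_sum_ge0 => b; rewrite lee_fin mulr_ge0 // prodr_ge0.
pose f u := iid_law mu [set y : n.-tuple R | agree (size a + n.+1) (same_value (x ++ u :: y)) r].
have fE u l : labelled (rcons x u) (rcons a l) -> f u = L l.
  move=> /IH IHr; rewrite /L -IHr /f size_rcons addSnnS; congr iid_law.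
  by apply/funext => y; rewrite /mkset cat_rcons.
(* Off the countable set C, the new point gets the label 0. *)
pose C := range z `|` range (nth 0 x).
have fC u : ~ C u -> f u = L 0%N.
  move=> Cu; apply: fE; apply: labelled_rcons => //.
    move=> i ia; rewrite andbF; apply/negbTE/negP => /eqP e; apply: Cu; right.
    by exists i.
  by move=> k _; apply/negbTE/negP => /eqP e; apply: Cu; left; exists k.
have fz k : c k.+1 != 0 -> f (z k) = L k.+1.
  move=> ck; apply: fE; apply: labelled_rcons => //.
    by move=> i ia; rewrite andbT; exact: az.
  move=> k' ck'; rewrite eqSS; apply/eqP/eqP => [|-> //]; exact: z_inj.
have f0 u : (0 <= f u)%E by exact: iid_law_ge0.
have cC : countable C.
  have cr (g : nat -> R) : countable (range g).
    by apply: sub_countable (card_image_le g setT) _; exact: countableP.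
  rewrite /C -bigcup2E; apply: bigcup_countable => // k _.
  by rewrite /bigcup2; case: k => [|[|k]] //=; exact: cr.
have mC D : D `<=` C -> measurable D.
  move=> DC; apply: countable_measurable; first by move=> t; exact: measurable_set1.
  exact: sub_countable (subset_card_le DC) cC.
have HC : H C = 0%E.
  apply/(@negligibleP _ _ _ H C (mC _ (@subset_refl _ C))).
  have nr (g : nat -> R) : H.-negligible (range g).
    rewrite (_ : range g = \bigcup_k [set g k]).
      apply: negligible_bigcup => k; by exists [set g k]; split; [exact: measurable_set1 | exact: H0 | ].
    by apply/seteqP; split => [_ [k _ <-]|_ [k _ ->]]; exists k.
  by apply: negligibleU.
(* f is constant off C, and every subset of C is measurable. *)
have mf : measurable_fun setT f.
  move=> _ B mB; rewrite setTI.
  have -> : f @^-1` B = (f @^-1` B `&` C) `|` (~` C `&` [set _ | B (L 0%N)]).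
    apply/seteqP; split => [u Bu|u [[]//|[/fC e /=]]]; last by rewrite -e.
    have [Cu|Cu] := pselect (C u); [by left | right; split => //=].
    by rewrite -(fC _ Cu).
  apply: measurableU; first by apply: mC; exact: subIsetr.
  apply: measurableI; first by apply: measurableC; exact: mC.
  have [BL|BL] := pselect (B (L 0%N)).
    have -> : [set _ : R | B (L 0%N)] = setT by apply/seteqP; split.
    exact: measurableT.
  have -> : [set _ : R | B (L 0%N)] = set0 by apply/seteqP; split.
  exact: measurable0.
rewrite [LHS]/=; transitivity (\int[mu]_u f u)%E.
  by apply: eq_integral => u _.
rewrite (ge0_integral_mixed c0 muE) //=; apply: eq_eseriesr => l _.
(* Atoms of weight 0 need not be distinct, but they do not contribute. *)
have [cl|cl] := eqVneq (c l) 0.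
  rewrite cl mul0e -[LHS](mul0e (L l)) -label_sumZl //.
  - by apply: eq_label_sum => b _; rewrite mul0e big_cons cl !mul0r.
  - by move=> b; rewrite lee_fin mulr_ge0 // prodr_ge0.
have -> : label_integral H z f l = L l.
  case: l cl => [|k] cl /=; last exact: fz.
  transitivity (\int[H]_u (cst (L 0%N) u))%E.
    apply: ae_eq_ge0_integral => // [u|]; first exact: L0.
    exists C; split => //; first exact: mC.
    by move=> u /= ne; apply: contrapT => Cu; apply: ne; exact: fC.
  transitivity (L 0%N * H setT)%E; first exact: integral_cst.
  by rewrite probability_setT mule1.
rewrite -label_sumZl //; last first.
  by move=> b; rewrite lee_fin mulr_ge0 // prodr_ge0.
apply: eq_label_sum => b _.
by rewrite -EFinM mulrA big_cons size_rcons addSnnS cat_rcons.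
Qed.

End MixedSamples.

(** * Partitions induced by labels *)

Section LabelPartition.
Local Open Scope nat_scope.

(** Label 0 marks the points drawn from the diffuse part: they form singletons. *)
Definition label_key (n : nat) (b : seq nat) (i : 'I_n) : 'I_n + nat :=
  if nth 0 b i == 0 then inl i else inr (nth 0 b i).

Definition label_partition (n : nat) (b : seq nat) : {set {set 'I_n}} :=
  preim_partition (label_key b) [set: 'I_n]%SET.

Lemma label_keyE n b (i j : 'I_n) :
  (label_key b i == label_key b j) = same_label b i j.
Proof.
rewrite /label_key /same_label.
have [bi|bi] := eqVneq (nth 0 b i) 0; have [bj|bj] := eqVneq (nth 0 b j) 0.
- by rewrite bi bj /= orbF.
- rewrite bi /= andbF orbF; apply/esym/negP => /eqP e.
  by rewrite -e bi in bj.
- rewrite bj (negPf bi) /= orbF; apply/esym/negP => /eqP e.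
  by rewrite e bj in bi.
- rewrite andbT; have [e|//] := eqVneq (val i) (val j); by rewrite e eqxx.
Qed.

Lemma label_partitionP n b : finset.partition (label_partition n b) [set: 'I_n]%SET.
Proof. exact: preim_partitionP. Qed.

Lemma label_partition_eqE n b b' :
  (label_partition n b == label_partition n b') = agree n (same_label b) (same_label b').
Proof.
have h (i j : 'I_n) : (finset.pblock (label_partition n b') i == finset.pblock (label_partition n b') j)
    = same_label b' i j.
  have /(preim_partition_eqP _ (label_partitionP n b')) <- := eqxx (label_partition n b').
  by rewrite label_keyE.
apply/(preim_partition_eqP _ (label_partitionP n b'))/forallP => [e i|e i j].
  by apply/forallP => j; rewrite -label_keyE e h.
by rewrite label_keyE h; have /forallP/(_ j)/eqP := e i.
Qed.

Lemma perm_label_partition n b :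
  perm_eq (enum (label_partition n b))
    ([seq [set i]%SET | i : 'I_n <- enum 'I_n & nth 0 b i == 0]
     ++ [seq [set i : 'I_n | nth 0 b i == k.+1]%SET
        | k <- undup [seq (nth 0 b i).-1 | i : 'I_n <- enum 'I_n & nth 0 b i != 0]]).
Proof.
have inS k : (k \in undup [seq (nth 0 b i).-1 | i : 'I_n <- enum 'I_n & nth 0 b i != 0])
    -> exists i : 'I_n, nth 0 b i = k.+1.
  rewrite mem_undup => /mapP[i]; rewrite mem_filter => /andP[bi _] ->.
  by exists i; rewrite prednK // lt0n.
apply: uniq_perm; first exact: enum_uniq.
  rewrite cat_uniq; apply/and3P; split.
  - by rewrite (map_inj_uniq (@finset.set1_inj _)) filter_uniq // enum_uniq.
  - apply/hasPn => _ /mapP[k /inS[i bi] ->]; apply/negP => /mapP[j].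
    rewrite mem_filter => /andP[/eqP bj _] /setP/(_ i).
    by rewrite !inE bi eqxx => /esym/eqP e; rewrite -e bi in bj.
  - rewrite map_inj_in_uniq ?undup_uniq // => k k' /inS[i bi] _ /setP/(_ i).
    by rewrite !inE bi eqxx => /esym/eqP[->].
move=> C; rewrite mem_enum mem_cat; apply/imsetP/orP => [[i _ ->]|].
  have [bi|bi] := eqVneq (nth 0 b i) 0; [left|right]; apply/mapP.
    exists i; first by rewrite mem_filter bi eqxx mem_enum.
    apply/setP => j; rewrite !inE label_keyE /same_label bi andbF orbF.
    by rewrite eq_sym val_eqE.
  exists (nth 0 b i).-1.
    by rewrite mem_undup; apply/mapP; exists i; rewrite // mem_filter bi mem_enum.
  apply/setP => j; rewrite !inE label_keyE /same_label bi andbT prednK ?lt0n //.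
  by rewrite [in RHS]eq_sym; case: eqP => // ->; rewrite eqxx.
move=> [] /mapP[].
  move=> i; rewrite mem_filter => /andP[/eqP bi _] ->; exists i => //.
  apply/setP => j; rewrite !inE label_keyE /same_label bi andbF orbF.
  by rewrite eq_sym val_eqE.
move=> k /inS[i bi] ->; exists i => //.
apply/setP => j; rewrite !inE label_keyE /same_label bi andbT.
rewrite [k.+1 == _]eq_sym; have [e|//] := eqVneq (val i) (val j).
by rewrite -e bi eqxx.
Qed.

End LabelPartition.

Lemma iid_law_partition (R : realType) (mu : {measure set R -> \bar R})
    (H : probability R R) (c z : nat -> _) (n : nat) (p : {set {set 'I_n}}) :
  (forall l, 0 <= c l) ->
  (forall A, measurable A ->
     (mu A = \sum_(0 <= l <oo) (c l)%:E * label_measure H z l A)%E) ->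
  (forall x, H [set x] = 0%E) ->
  (forall k k', c k.+1 != 0 -> c k'.+1 != 0 -> z k = z k' -> k = k') ->
  finset.partition p [set: 'I_n]%SET ->
  iid_law mu [set x : n.-tuple R | preim_partition (tnth x) [set: 'I_n]%SET = p] =
  label_sum n (fun b => (\prod_(l <- b) c l * (label_partition n b == p)%:R)%:E).
Proof.
move=> c0 muE H0 zi hp.
pose s := [seq finset.pblock p i | i <- enum 'I_n].
pose r i j := nth finset.set0 s i == nth finset.set0 s j.
have sE (i : 'I_n) : nth finset.set0 s i = finset.pblock p i.
  by rewrite (nth_map i) ?size_enum_ord // nth_ord_enum.
have lab0 : labelled c z [::] [::] by split.
have := iid_law_labelled c0 muE H0 zi n r lab0; rewrite /= add0n.
rewrite (_ : [set y : n.-tuple R | _] =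
    [set x : n.-tuple R | preim_partition (tnth x) [set: 'I_n]%SET = p]).
  move=> ->; apply: eq_label_sum => b _; congr ((_ * (nat_of_bool _)%:R)%:E).
  rewrite /label_partition; apply/forallP/(preim_partition_eqP _ hp) => [e i j|e i].
    by have /forallP/(_ j)/eqP := e i; rewrite /r !sE label_keyE.
  by apply/forallP => j; rewrite /r !sE -e label_keyE.
apply/funext => y; apply/propext; rewrite /mkset; split.
  move=> /forallP e; apply/eqP/(preim_partition_eqP _ hp) => i j.
  by have /forallP/(_ j)/eqP := e i; rewrite /r !sE /same_value -!tnth_nth.
move=> /eqP/(preim_partition_eqP _ hp) e; apply/forallP => i; apply/forallP => j.
by rewrite /r !sE /same_value -!tnth_nth e.
Qed.

(** * Weights and atoms of the species sampling model *)

Section Weights.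
Context (d : measure_display) (T : measurableType d) (R : realType).
Variables (K : pred nat) (W : nat -> {mfun T >-> R}).

Definition clip01 (x : R) : R := Num.min 1 `|x|.

Definition atom_weight (k : nat) (w : T) : R := if K k then clip01 (W k w) else 0.

(** Clipping to the unit interval makes the weights bounded everywhere and not
    only outside a null set. *)
Definition label_weight (l : nat) (w : T) : R :=
  if l is k.+1 then atom_weight k w
  else clip01 (1 - fine (\sum_(0 <= k <oo) (atom_weight k w)%:E)%E).

Lemma clip01_itv x : 0 <= clip01 x <= 1.
Proof. by rewrite /clip01 le_min ler01 normr_ge0 ge_min lexx. Qed.

Lemma clip01_id x : 0 <= x <= 1 -> clip01 x = x.
Proof. by case/andP => x0 x1; rewrite /clip01 ger0_norm // min_r. Qed.

Lemma label_weight_itv l w : 0 <= label_weight l w <= 1.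
Proof.
by case: l => [|k] /=; rewrite /atom_weight ?clip01_itv //; case: ifP => _;
  rewrite ?clip01_itv // lexx ler01.
Qed.

Lemma label_weight_ge0 l w : 0 <= label_weight l w.
Proof. by case/andP: (label_weight_itv l w). Qed.

Lemma prod_label_weight_itv b w : 0 <= \prod_(l <- b) label_weight l w <= 1.
Proof.
rewrite prodr_ge0 => [|l _]; last exact: label_weight_ge0.
by rewrite /= prodr_ile1 // => l _; exact: label_weight_itv.
Qed.

(** Measurability on this type says that the preimages of Borel sets are events
    of the family, to which the independence of weights and atoms applies. *)
Definition family_type (V : nat -> {mfun T >-> R}) :=
  g_sigma_algebraType [set E : set T | exists k (B : set R),
    [/\ K k, measurable B & E = V k @^-1` B]].

Lemma measurable_family (V : nat -> {mfun T >-> R}) k : K k ->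
  measurable_fun setT (V k : family_type V -> R).
Proof.
by move=> Kk _ B mB; rewrite setTI; apply: sub_sigma_algebra; exists k, B.
Qed.

Lemma family_events_measurable (V : nat -> {mfun T >-> R}) (E : set T) :
  family_events K V E -> measurable E.
Proof.
apply: smallest_sub; first exact: sigma_algebra_measurable.
by move=> _ [k [B [_ mB ->]]]; exact: measurable_funPTI.
Qed.

Lemma measurable_clip01 d' (U : measurableType d') (f : U -> R) :
  measurable_fun setT f -> measurable_fun setT (fun x => clip01 (f x)).
Proof. by move=> mf; apply: measurable_minr => //; apply: measurableT_comp. Qed.

Lemma family_label_weight l :
  measurable_fun setT (label_weight l : family_type W -> R).
Proof.
have ma k : measurable_fun setT (atom_weight k : family_type W -> R).
  rewrite /atom_weight; have [Kk|Kk] := boolP (K k); last exact: measurable_cst.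
  by apply: measurable_clip01; exact: measurable_family.
case: l => [|k]; last exact: ma.
apply: (@measurable_clip01 _ (family_type W)
  (fun w => 1 - fine (\sum_(0 <= k <oo) (atom_weight k w)%:E)%E)).
apply: measurable_funB => //; apply: measurableT_comp; first exact: fine_measurable.
apply: (@ge0_emeasurable_sum _ _ _ setT (fun k (w : family_type W) => (atom_weight k w)%:E) xpredT).
  by move=> k w _ _; rewrite lee_fin; exact: (label_weight_ge0 k.+1).
by move=> k _; exact/measurable_EFinP.
Qed.

Lemma measurable_of_family (V : nat -> {mfun T >-> R}) (f : T -> R) :
  measurable_fun setT (f : family_type V -> R) -> measurable_fun setT f.
Proof.
move=> mf _ B mB; apply: (@family_events_measurable V).
exact: mf.
Qed.

End Weights.

Section SpeciesSampling.
Context (d : measure_display) (T : measurableType d) (R : realType).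
Variables (P : probability T R) (H : probability R R) (K : pred nat).
Variables (W xi : nat -> {RV P >-> R}) (G : R.-pker T ~> R).
Hypothesis hG : species_sampling_model H K W xi G.

Let wt := label_weight K W.

Lemma ae_species_mixture : {ae P, forall w, forall A : set R, measurable A ->
  (G w A = \sum_(0 <= l <oo) (wt l w)%:E * label_measure H (xi^~ w) l A)%E}.
Proof.
apply: filterS (ssm_form hG) => w [W01 Wle GE] A mA.
have clipW k : K k -> clip01 (W k w) = W k w.
  by move=> /W01 /andP[a b]; rewrite clip01_id // !ltW.
pose S := (\sum_(0 <= k <oo | K k) (W k w)%:E)%E.
have SE : (\sum_(0 <= k <oo) (atom_weight K W k w)%:E)%E = S.
  rewrite [RHS]eseries_mkcond; apply: eq_eseriesr => k _; rewrite /atom_weight.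
  by case: ifP => // Kk; rewrite clipW.
have S0 : (0 <= S)%E by apply: nneseries_ge0 => k _ /W01 /andP[a _]; rewrite lee_fin ltW.
have Sfin : S \is a fin_num by rewrite ge0_fin_numE // (le_lt_trans Wle) ?ltry.
have w0 : ((wt 0 w)%:E = 1 - S)%E.
  rewrite /wt /= SE -[in RHS](fineK Sfin) clip01_id // subr_ge0 gerBl.
  by rewrite -!lee_fin fineK // Wle S0.
rewrite GE // [RHS]nneseries_recl //; last first.
  by move=> l _; rewrite mule_ge0 // lee_fin label_weight_ge0.
rewrite [LHS]addeC w0; congr (_ + _)%E.
rewrite -(@nneseries_addn _ _ 1) => [|l]; last first.
  by rewrite mule_ge0 // lee_fin label_weight_ge0.
rewrite [LHS]eseries_mkcond; apply: eq_eseriesr => k _; rewrite addn1 /= /atom_weight.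
by case: ifP => Kk; rewrite ?mul0e // clipW.
Qed.

Lemma ae_sum_label_weight : {ae P, forall w,
  (\sum_(0 <= l <oo) (wt l w)%:E = 1)%E}.
Proof.
apply: filterS ae_species_mixture => w /(_ setT measurableT).
rewrite prob_kernel => ->; apply: eq_eseriesr => l _.
by case: l => [|l] /=; rewrite ?probability_setT ?diracT mule1.
Qed.

Lemma ae_atoms_distinct : {ae P, forall w k k',
  wt k.+1 w != 0 -> wt k'.+1 w != 0 -> xi k w = xi k' w -> k = k'}.
Proof.
apply: ae_foralln => k; apply: ae_foralln => k'.
have [->|kk'] := eqVneq k k'; first exact: aeW.
have [Kk|Kk] := boolP (K k); last first.
  by apply: aeW => w; rewrite /wt /= /atom_weight (negPf Kk) eqxx.
have [Kk'|Kk'] := boolP (K k'); last first.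
  by apply: aeW => w; rewrite /wt /= /atom_weight (negPf Kk') eqxx.
exists [set w | xi k w = xi k' w]; split.
- have := @measurable_fun_eqr _ T R setT (xi k) (xi k').
  move=> /(_ (measurable_funPT _) (measurable_funPT _) measurableT [set true]).
  rewrite setTI => h; have -> : [set w | xi k w = xi k' w] =
    (fun w => xi k w == xi k' w) @^-1` [set true].
    by apply/seteqP; split => w /= /eqP.
  exact: h.
- exact: (iid_nonatomic_neq (ssm_atoms_iid hG) (ssm_nonatomic hG)).
- by move=> w /= h; apply: contrapT => e; apply: h => _ _ /e.
Qed.

End SpeciesSampling.

(** * The mixture formula *)

Section BoundedDensities.
Context (R : realType).

Definition bounded_density (f : R -> R) : Prop :=
  measurable_fun setT f /\ exists M, forall x, 0 <= f x <= M.

Lemma bounded_density_prod (I : Type) (s : seq I) (Q : pred I) (f : I -> R -> R) :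
  (forall i, bounded_density (f i)) ->
  bounded_density (fun x => \prod_(i <- s | Q i) f i x).
Proof.
move=> bf; elim: s => [|i s [mIH [M hM]]].
  under eq_fun do rewrite big_nil.
  by split; [exact: measurable_cst | exists 1 => x; rewrite ler01 lexx].
under eq_fun do rewrite big_cons.
case: (Q i); last by split; [exact: mIH | exists M].
have [mf [M' hM']] := bf i; split; first exact: measurable_funM.
exists (M' * M) => x; have /andP[a b] := hM x; have /andP[a' b'] := hM' x.
by rewrite mulr_ge0 // ler_pM.
Qed.

Lemma bounded_density_ge0 f x : bounded_density f -> 0 <= f x.
Proof. by move=> [_ [M /(_ x) /andP[]]]. Qed.

Lemma bounded_density_fin (mu : {measure set R -> \bar R}) (f : R -> R) :
  mu setT = 1%E -> bounded_density f -> (\int[mu]_x (f x)%:E \is a fin_num)%E.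
Proof.
move=> mu1 [mf [M hM]].
have f0 x : 0 <= f x by case/andP: (hM x).
rewrite ge0_fin_numE; last by apply: integral_ge0 => x _; rewrite lee_fin.
apply: (@le_lt_trans _ _ (\int[mu]_x (cst M%:E x))%E); last first.
  by rewrite integral_cst // [X in (_ * X)%E]mu1 mule1 ltry.
apply: ge0_le_integral => //.
- by move=> x _; rewrite lee_fin.
- exact/measurable_EFinP.
- by move=> x _; rewrite lee_fin; case/andP: (hM x).
Qed.

End BoundedDensities.

Section SpeciesLabels.
Context (d : measure_display) (T : measurableType d) (R : realType).
Variables (P : probability T R) (H : probability R R) (K : pred nat).
Variables (W xi : nat -> {RV P >-> R}) (G : R.-pker T ~> R).
Hypothesis hG : species_sampling_model H K W xi G.

Let wt := label_weight K W.

Definition label_prob (b : seq nat) : \bar R := (\int[P]_w (\prod_(l <- b) wt l w)%:E)%E.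

Lemma label_prob_ge0 b : (0 <= label_prob b)%E.
Proof.
apply: integral_ge0 => w _; rewrite lee_fin.
by case/andP: (prod_label_weight_itv K W b w).
Qed.

Lemma measurable_prod_weight b : measurable_fun setT (fun w => \prod_(l <- b) wt l w).
Proof.
apply: measurable_prod => l _.
by apply: (@measurable_of_family _ _ _ K W); exact: family_label_weight.
Qed.

Definition cell_integral (n : nat) (k : nat -> R -> R) (C : {set 'I_n}) : R :=
  \int[H]_x \prod_(i in C) k i x.

Lemma big_label_partition (n : nat) (b : seq nat) (F : {set 'I_n} -> R) :
  \prod_(C in label_partition n b) F C =
  \prod_(i < n | nth 0%N b i == 0%N) F [set i]%SET *
  \prod_(k <- undup [seq (nth 0%N b i).-1 | i : 'I_n <- enum 'I_n & nth 0%N b i != 0%N])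
     F [set i : 'I_n | nth 0%N b i == k.+1]%SET.
Proof.
rewrite -[LHS]big_enum (perm_big _ (perm_label_partition n b)) /= big_cat /=.
rewrite !big_map big_filter; congr (_ * _).
exact: big_enum_cond.
Qed.

(** Independence of weights and atoms separates the weights; the atoms that occur
    are distinct indices of an i.i.d. family, so that their expectation is a
    product over the cells. *)
Lemma label_prob_split (n : nat) (b : seq nat) (k : nat -> R -> R) :
  size b = n -> (forall i, bounded_density (k i)) ->
  (\int[P]_w (\prod_(l <- b) wt l w
     * \prod_(i < n) label_mean H (xi^~ w) (k i) (nth 0%N b i))%:E)%E =
  (label_prob b * (\prod_(C in label_partition n b) cell_integral k C)%:E)%E.
Proof.
move=> bn bk; have k0 i x : 0 <= k i x by exact: bounded_density_ge0.
(* A label k + 1 with k outside K has weight 0, and both sides vanish. *)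
have [/allP allK|/allPn[l lb]] := boolP (all (fun l => (l == 0%N) || K l.-1) b); last first.
  rewrite negb_or => /andP[l0 Kl].
  have wt0 w : \prod_(l <- b) wt l w = 0.
    apply/eqP; rewrite prodf_seq_eq0; apply/hasP; exists l => //=.
    by case: l l0 Kl {lb} => //= k' _ Kk; rewrite /atom_weight (negPf Kk).
  rewrite /label_prob; under eq_integral do rewrite wt0 mul0r.
  by under [in RHS]eq_integral do rewrite wt0; rewrite integral0 mul0e.
set s := undup [seq (nth 0%N b i).-1 | i : 'I_n <- enum 'I_n & nth 0%N b i != 0%N].
pose g j x := \prod_(i in [set i : 'I_n | nth 0%N b i == j.+1]%SET) k i x.
pose c := \prod_(i < n | nth 0%N b i == 0%N) \int[H]_x k i x.
have sK : all K s.
  apply/allP => j; rewrite mem_undup => /mapP[i]; rewrite mem_filter => /andP[bi _] ->.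
  by have := allK _ (mem_nth 0%N _); rewrite bn => /(_ _ (ltn_ord i)); rewrite (negPf bi).
have bg j : bounded_density (g j) by exact: bounded_density_prod.
have c0 : 0 <= c by apply: prodr_ge0 => i _; apply: Rintegral_ge0.
have YE w : \prod_(i < n) label_mean H (xi^~ w) (k i) (nth 0%N b i) =
    c * \prod_(j <- s) g j (xi j w).
  transitivity (\prod_(i in [set: 'I_n]%SET) label_mean H (xi^~ w) (k i) (nth 0%N b i)).
    by apply: eq_bigl => i; rewrite inE.
  rewrite (set_partition_big (label_partition n b)) ?label_partitionP //=.
  rewrite big_label_partition; congr (_ * _).
    by apply: eq_bigr => i /eqP bi; rewrite big_set1 bi.
  by apply: eq_bigr => j _; apply: eq_bigr => i; rewrite inE => /eqP ->.
under eq_integral do rewrite YE.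
have mZ := @family_label_weight _ _ _ K W.
have mZb : measurable_fun setT ((fun w => \prod_(l <- b) wt l w) : family_type K W -> R).
  by apply: measurable_prod => l _; exact: mZ.
have mY : measurable_fun setT ((fun w => c * \prod_(j <- s) g j (xi j w)) : family_type K xi -> R).
  apply: measurable_funM => //.
  apply: measurable_prod => j /(allP sK) Kj.
  by apply: measurableT_comp; [case: (bg j) | exact: measurable_family].
rewrite ge0_integral_indep; last 5 first.
- exact: (@measurable_of_family _ _ _ K W).
- exact: (@measurable_of_family _ _ _ K xi).
- by move=> w; exact: prod_label_weight_itv.
- by move=> w; rewrite mulr_ge0 // prodr_ge0 // => j _; apply: prodr_ge0.
- move=> A B mA mB; apply: (ssm_weights_indep hG).
    by have := mZb measurableT _ mA; rewrite setTI.
  by have := mY measurableT _ mB; rewrite setTI.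
congr (_ * _)%E; under eq_integral do rewrite EFinM.
have mg j : measurable_fun setT (g j) by case: (bg j).
rewrite ge0_integralZl_EFin //; last 2 first.
- by move=> w _; rewrite lee_fin prodr_ge0 // => j _; apply: prodr_ge0.
- apply/measurable_EFinP; apply: measurable_prod => j _.
  exact: measurableT_comp.
rewrite (ge0_integral_prod_iid (ssm_atoms_iid hG)) ?undup_uniq //; last 2 first.
- by move=> j x; apply: prodr_ge0.
- by move=> j; apply: bounded_density_fin => //; exact: probability_setT.
rewrite -EFinM big_label_partition; congr ((_ * _)%:E).
by apply: eq_bigr => i _; apply: eq_Rintegral => x _; rewrite big_set1.
Qed.

Variable chi : seq nat -> R.
Hypothesis hchi : is_eppf P G chi.

(** The partition of a sample is almost surely the one induced by the labels of
    its points. *)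
Lemma eppf_label_sum (n : nat) (p : {set {set 'I_n}}) (e : seq nat) :
  finset.partition p [set: 'I_n]%SET ->
  perm_eq e [seq #|C| | C : {set 'I_n} in p] ->
  (chi e)%:E =
  label_sum n (fun b => label_prob b * ((label_partition n b == p)%:R)%:E)%E.
Proof.
move=> hp /(hchi hp) <-.
rewrite (@ae_eq_ge0_integral _ _ _ P _ (fun w => label_sum n (fun b =>
   (\prod_(l <- b) wt l w * (label_partition n b == p)%:R)%:E))).
- rewrite integral_label_sum.
  + apply: eq_label_sum => b _; under eq_integral do rewrite EFinM.
    rewrite ge0_integralZr //.
    * exact/measurable_EFinP/measurable_prod_weight.
    * by move=> w _; rewrite lee_fin; case/andP: (prod_label_weight_itv K W b w).
  + move=> w b; rewrite lee_fin mulr_ge0 //.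
    by case/andP: (prod_label_weight_itv K W b w).
  + move=> b; apply/measurable_EFinP; apply: measurable_funM => //.
    exact: measurable_prod_weight.
- by move=> w; exact: iid_law_ge0.
- move=> w; apply: label_sum_ge0 => b; rewrite lee_fin mulr_ge0 //.
  by case/andP: (prod_label_weight_itv K W b w).
- near=> w; rewrite (iid_law_partition (c := wt^~ w) (z := xi^~ w) (H := H)) //.
  + by move=> l; exact: label_weight_ge0.
  + by near: w; exact: (ae_species_mixture hG).
  + exact: ssm_nonatomic hG.
  + by near: w; exact: (ae_atoms_distinct hG).
Unshelve. all: by end_near. Qed.

Definition eppf_of_partition (n : nat) (p : {set {set 'I_n}}) : R :=
  chi (cell_sizes p).

(** The law of an exchangeable sample, tested on product functions: given the
    partition, the unique values are i.i.d. from H. *)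
Lemma eppf_mixture (n : nat) (k : nat -> R -> R) :
  (forall i, bounded_density (k i)) ->
  \int[P]_w (\prod_(i < n) \int[G w]_x k i x) =
  \sum_(p : {set {set 'I_n}} | finset.partition p [set: 'I_n]%SET)
     eppf_of_partition p * \prod_(C in p) cell_integral k C.
Proof.
move=> bk; have k0 i x : 0 <= k i x by exact: bounded_density_ge0.
have cell0 (n' : nat) (C : {set 'I_n'}) : 0 <= cell_integral k C.
  by apply: Rintegral_ge0 => x _; apply: prodr_ge0.
suff e : (\int[P]_w (\prod_(i < n) \int[G w]_x k i x)%:E)%E =
    (\sum_(p : {set {set 'I_n}} | finset.partition p [set: 'I_n]%SET)
     eppf_of_partition p * \prod_(C in p) cell_integral k C)%:E.
  by rewrite /Rintegral -[RHS]/(fine _%:E) -e.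
have mean0 w i l : 0 <= label_mean H (xi^~ w) (k i) l by exact: label_mean_ge0.
rewrite (@ae_eq_ge0_integral _ _ _ P _ (fun w => label_sum n (fun b =>
   (\prod_(l <- b) wt l w * \prod_(i < n) label_mean H (xi^~ w) (k i) (nth 0%N b i))%:E))).
- rewrite integral_label_sum.
  + transitivity (label_sum n (fun b =>
        \sum_(p : {set {set 'I_n}} | finset.partition p [set: 'I_n]%SET)
          (\prod_(C in p) cell_integral k C)%:E *
          (label_prob b * ((label_partition n b == p)%:R)%:E)))%E.
      apply: eq_label_sum => b bn; rewrite label_prob_split //.
      rewrite (bigD1 (label_partition n b)) /= ?label_partitionP // eqxx mule1.
      rewrite [X in _ + X]big1; first by rewrite adde0 muleC.
      by move=> p /andP[_ /negPf]; rewrite eq_sym => ->; rewrite !mule0.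
    rewrite label_sum_sum => [|p b]; last first.
      by rewrite !mule_ge0 ?lee_fin ?prodr_ge0 // label_prob_ge0.
    rewrite -sumEFin; apply: eq_bigr => p hp; rewrite label_sumZl ?prodr_ge0 //.
      by rewrite -(eppf_label_sum hp (perm_refl _)) -EFinM mulrC.
    by move=> b; rewrite mule_ge0 ?lee_fin // label_prob_ge0.
  + move=> w b; rewrite lee_fin; apply: mulr_ge0; last exact: prodr_ge0.
    by case/andP: (prod_label_weight_itv K W b w).
  + move=> b; apply/measurable_EFinP; apply: measurable_funM.
      exact: measurable_prod_weight.
    apply: measurable_prod => i _; case: (nth 0%N b i) => [|l] //=.
    by apply: measurableT_comp => //; case: (bk i).
- by move=> w; rewrite lee_fin; apply: prodr_ge0 => i _; apply: Rintegral_ge0.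
- move=> w; apply: label_sum_ge0 => b; rewrite lee_fin; apply: mulr_ge0; last exact: prodr_ge0.
  by case/andP: (prod_label_weight_itv K W b w).
- near=> w; apply: prod_integral_mixed => //.
  + by move=> l; exact: label_weight_ge0.
  + by near: w; exact: (ae_species_mixture hG).
  + by move=> i; case: (bk i).
  + by move=> i; apply: bounded_density_fin => //; exact: probability_setT.
  + by move=> i; apply: bounded_density_fin => //; exact: prob_kernel.
Unshelve. all: by end_near. Qed.

End SpeciesLabels.

(** * Symmetry and monotonicity of the partition probabilities *)

Section LabelLists.
Local Open Scope nat_scope.

Lemma undup_map_in (T1 T2 : eqType) (f : T1 -> T2) (s : seq T1) :
  {in s &, injective f} -> undup (map f s) = map f (undup s).
Proof.
elim: s => //= x s IH fI.
have -> : (f x \in map f s) = (x \in s).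
  apply/mapP/idP => [[y ys xy]|xs]; last by exists x.
  by rewrite (fI x y) // inE ?eqxx ?ys ?orbT.
have -> : undup (map f s) = map f (undup s).
  by apply: IH => y z ys zs; apply: fI; rewrite inE ?ys ?zs orbT.
by case: ifP.
Qed.

Lemma card_label_class (b : seq nat) x :
  #|[set i : 'I_(size b) | nth 0 b i == x]%SET| = count_mem x b.
Proof.
by rewrite cardsE -sum1_card -sum1_count (big_nth 0) big_mkord.
Qed.

Lemma perm_label_sizes (b : seq nat) : 0 \notin b ->
  perm_eq [seq #|C| | C : {set 'I_(size b)} in label_partition (size b) b]
          [seq count_mem l b | l <- undup b].
Proof.
move=> b0; have bi (i : 'I_(size b)) : nth 0 b i != 0.
  by apply: contraNneq b0 => <-; exact: mem_nth.
apply: perm_trans (perm_map _ (perm_label_partition _ b)) _.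
rewrite (eq_filter (a2 := pred0)) => [|i]; last by rewrite (negPf (bi i)).
rewrite filter_pred0 (eq_filter (a2 := predT)) => [|i]; last by rewrite bi.
rewrite filter_predT /= -map_comp.
have -> : [seq (nth 0 b i).-1 | i : 'I_(size b) <- enum 'I_(size b)] = map predn b.
  rewrite (map_comp (fun j => (nth 0 b j).-1) val) val_enum_ord.
  by rewrite (map_comp predn (nth 0 b)) -/(mkseq (nth 0 b) (size b)) mkseq_nth.
have pb : {in b &, injective predn}.
  by move=> [|x] [|y]; rewrite ?(negPf b0) // => _ _ /= ->.
rewrite undup_map_in // -map_comp.
rewrite (_ : map _ _ = [seq count_mem l b | l <- undup b]) //.
apply/eq_in_map => l; rewrite mem_undup => lb /=.
have l0 : 0 < l by rewrite lt0n; apply: contraNneq b0 => <-.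
by rewrite card_label_class prednK.
Qed.

Lemma count_undup_nseq m l (b : seq nat) : l \notin b ->
  perm_eq [seq count_mem x (nseq m.+1 l ++ b) | x <- undup (nseq m.+1 l ++ b)]
          (m.+1 :: [seq count_mem x b | x <- undup b]).
Proof.
move=> lb.
have -> : undup (nseq m.+1 l ++ b) = l :: undup b.
  elim: m => [|m IH] /=; first by rewrite (negPf lb).
  by rewrite inE eqxx /= -IH.
rewrite map_cons count_cat count_nseq /= eqxx mul1n (count_memPn lb) addn0.
rewrite perm_cons (_ : map _ _ = [seq count_mem x b | x <- undup b]) //.
apply/eq_in_map => x; rewrite mem_undup => xb.
rewrite count_cat count_nseq /=.
by case: eqP lb => [->|]; rewrite ?xb // mul0n.
Qed.

(** A fresh label for each entry, repeated as often as the entry says. Hence any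
    list of positive integers occurs as the list of cell sizes of a partition. *)
Lemma exists_labels (e : seq nat) : all (leq 1) e ->
  exists2 b, 0 \notin b & perm_eq [seq count_mem x b | x <- undup b] e.
Proof.
elim: e => [|[|m] e IH] //=; first by exists [::].
move=> /IH [b b0 be]; pose l := (\max_(x <- b) x).+1.
have lb : l \notin b.
  apply/negP => /(@leq_bigmax_seq _ _ xpredT id) /(_ isT).
  by rewrite ltnn.
exists (nseq m.+1 l ++ b); first by rewrite mem_cat negb_or b0 andbT mem_nseq.
by apply: perm_trans (count_undup_nseq m lb) _; rewrite perm_cons.
Qed.

End LabelLists.

Section EppfLists.
Context (d : measure_display) (T : measurableType d) (R : realType).
Variables (P : probability T R) (H : probability R R) (K : pred nat).
Variables (W xi : nat -> {RV P >-> R}) (G : R.-pker T ~> R).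
Hypothesis hG : species_sampling_model H K W xi G.
Variable chi : seq nat -> R.
Hypothesis hchi : is_eppf P G chi.

Lemma eppf_sizes (n : nat) (p : {set {set 'I_n}}) (e : seq nat) :
  finset.partition p [set: 'I_n]%SET ->
  perm_eq e [seq #|C| | C : {set 'I_n} in p] -> chi e = eppf_of_partition chi p.
Proof.
move=> hp pe; apply: EFin_inj.
by rewrite -(hchi hp pe) (hchi hp (perm_refl _)).
Qed.

(** Symmetry is inherited from the partition probabilities, which depend on the
    partition only. *)
Lemma eppf_perm (e e' : seq nat) : all (leq 1%N) e -> perm_eq e e' -> chi e = chi e'.
Proof.
move=> /exists_labels[b b0 be] ee'.
have pb := label_partitionP (size b) b.
rewrite (eppf_sizes (e := e) pb); last first.
  by rewrite perm_sym (perm_trans (perm_label_sizes b0)).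
rewrite -(eppf_sizes (e := e') pb) // perm_sym.
by rewrite (perm_trans (perm_label_sizes b0)) // (perm_trans be).
Qed.

Lemma eppf_ge0 (e : seq nat) : all (leq 1%N) e -> 0 <= chi e.
Proof.
move=> /exists_labels[b b0 be]; rewrite -lee_fin.
rewrite (eppf_label_sum hG hchi (label_partitionP (size b) b)); last first.
  by rewrite perm_sym (perm_trans (perm_label_sizes b0)).
apply: label_sum_ge0 => b'; rewrite mule_ge0 ?lee_fin //; exact: label_prob_ge0.
Qed.

(** The weights of all labels, the diffuse one included, sum to 1. *)
Lemma sum_label_prob_cons (b : seq nat) :
  (\sum_(0 <= l <oo) label_prob K W (l :: b) = label_prob K W b)%E.
Proof.
have wt0 l w : 0 <= label_weight K W l w by exact: label_weight_ge0.
have pw0 b' w : 0 <= \prod_(l <- b') label_weight K W l w.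
  by apply: prodr_ge0 => l _.
rewrite /label_prob -integral_nneseries //; last 2 first.
- by move=> l; apply/measurable_EFinP; exact: measurable_prod_weight.
- by move=> l w _; rewrite lee_fin.
apply: ae_eq_ge0_integral.
- by move=> w; apply: nneseries_ge0 => l _ _; rewrite lee_fin.
- by move=> w; rewrite lee_fin.
apply: filterS (ae_sum_label_weight hG) => w w1.
under eq_eseriesr do rewrite big_cons mulrC EFinM.
by rewrite nneseriesZl ?w1 ?mule1 // => l _; rewrite lee_fin.
Qed.

(** Forgetting the first point can only increase the probability of the pattern
    of coincidences of the others: sum over its label. *)
Lemma eppf_behead (l0 : nat) (b0 : seq nat) (n := size b0) :
  eppf_of_partition chi (label_partition n.+1 (l0 :: b0)) <=
  eppf_of_partition chi (label_partition n b0).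
Proof.
rewrite -lee_fin !(eppf_label_sum hG hchi (label_partitionP _ _) (perm_refl _)) /=.
set p := label_partition n b0; set p' := label_partition n.+1 (l0 :: b0).
have q0 b l c : (0 <= label_prob K W (l :: b) * (c : bool)%:R%:E)%E.
  by rewrite mule_ge0 ?lee_fin // label_prob_ge0.
apply: (@le_trans _ _ (\sum_(0 <= l <oo) label_sum n (fun b =>
    label_prob K W (l :: b) * (label_partition n b == p)%:R%:E))%E).
  apply: lee_nneseries => l *; first by apply: label_sum_ge0 => b.
  apply: le_label_sum => // b _; apply: lee_wpmul2l; first exact: label_prob_ge0.
  rewrite lee_fin ler_nat; case: eqP => [e|//].
  have /eqP := e; rewrite label_partition_eqE => /forallP h.
  rewrite label_partition_eqE (_ : agree _ _ _) //; apply/forallP => i; apply/forallP => j.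
  have i1 : (i.+1 < n.+1)%N by rewrite ltnS.
  have j1 : (j.+1 < n.+1)%N by rewrite ltnS.
  by have /forallP/(_ (Ordinal j1)) := h (Ordinal i1).
rewrite label_sum_series //; apply: le_label_sum => [b|b _].
  exact: nneseries_ge0.
under eq_eseriesr do rewrite muleC.
rewrite nneseriesZl; last by move=> l _; exact: label_prob_ge0.
by rewrite muleC sum_label_prob_cons.
Qed.

Lemma eppf_cons_le (m : nat) (e : seq nat) : all (leq 1%N) e ->
  chi (m.+1 :: e) <= chi (if m is 0%N then e else m :: e).
Proof.
move=> /exists_labels[b b0 be]; pose l := (\max_(x <- b) x).+1.
have lb : l \notin b.
  apply/negP => /(@leq_bigmax_seq _ _ xpredT id) /(_ isT).
  by rewrite ltnn.
have z0 k : 0%N \notin nseq k l ++ b by rewrite mem_cat negb_or b0 andbT mem_nseq andbF.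
have -> : chi (m.+1 :: e) = eppf_of_partition chi
    (label_partition (size (nseq m.+1 l ++ b)) (nseq m.+1 l ++ b)).
  apply: eppf_sizes; first exact: label_partitionP.
  rewrite perm_sym (perm_trans (perm_label_sizes (z0 _))) //.
  by rewrite (perm_trans (count_undup_nseq m lb)) // perm_cons.
apply: le_trans (eppf_behead l (nseq m l ++ b)) _.
rewrite -(eppf_sizes (e := if m is 0%N then e else m :: e)) //; first exact: label_partitionP.
rewrite perm_sym (perm_trans (perm_label_sizes (z0 _))) //.
case: m => [|m] //.
by rewrite (perm_trans (count_undup_nseq m lb)) // perm_cons.
Qed.

Lemma eppf_cons0 (m : nat) (e : seq nat) : all (leq 1%N) e ->
  chi (if m is 0%N then e else m :: e) = 0 -> chi (m.+1 :: e) = 0.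
Proof.
move=> e1 c0; apply/eqP; rewrite eq_le -{1}c0 eppf_cons_le // eppf_ge0 //.
Qed.

(** The sample grows one point at a time, so that chi stays 0. *)
Lemma eppf_cat0 (e e' : seq nat) : all (leq 1%N) e -> all (leq 1%N) e' ->
  chi e = 0 -> chi (e ++ e') = 0.
Proof.
move=> e1 e1' c0; have ee' : perm_eq (e ++ e') (e' ++ e) by rewrite perm_catC.
rewrite (eppf_perm _ ee') ?all_cat ?e1 // {ee'}.
elim: e' e1' => //= m e' IH /andP[m1 e1']; case: m m1 => // m _.
have a : all (leq 1%N) (e' ++ e) by rewrite all_cat e1'.
elim: m => [|m IHm]; first by apply: eppf_cons0 => //; exact: IH.
by apply: eppf_cons0.
Qed.

End EppfLists.

(** * The kernel of the unimodal density *)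

Section Kernel.
Context {R : realType}.

Definition kern (s x : R) : R :=
  x^-1 * ((0 < s <= x)%R%:R - (x <= s < 0)%R%:R).

(** The reflection that reduces negative observations to positive ones. *)
Lemma kernN s x : kern (- s) (- x) = kern s x.
Proof.
rewrite /kern !oppr_gt0 !oppr_lt0 !lerN2 invrN mulNr -mulrN opprB.
by rewrite ![(_ <= _) && _]andbC.
Qed.

Lemma kern_pos s x : 0 < s -> kern s x = (s <= x)%R%:R * x^-1.
Proof.
by move=> s0; rewrite /kern s0 (lt_gtF s0) andbF subr0 mulrC.
Qed.

Lemma kern0 x : kern 0 x = 0.
Proof. by rewrite /kern ltxx andbF subrr mulr0. Qed.

Lemma kern_opp_sign s s' x : 0 < s -> s' < 0 -> kern s x * kern s' x = 0.
Proof.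
move=> s0 s'0; rewrite -(kernN s') !kern_pos ?oppr_gt0 //.
have [sx|] := leP s x; last by rewrite !mul0r.
rewrite [(- s' <= - x)%R](_ : _ = false) ?mul0r ?mulr0 //.
by apply/negbTE; rewrite lerN2 -ltNge (lt_trans s'0) // (lt_le_trans s0).
Qed.

(** The kernel vanishes for x between 0 and s, which bounds 1 / x by 1 / s. *)
Lemma bounded_density_kern s : bounded_density (kern s).
Proof.
have pos s' : 0 < s' -> bounded_density (kern s').
  move=> s0; split.
    rewrite (_ : kern s' = fun x => \1_(`[s', +oo[%classic) x * x `^ (-1)).
      by apply: measurable_funM; [exact: measurable_indic | exact: measurable_powR].
    apply/funext => x; rewrite kern_pos // indicE mem_setE in_itv /= andbT.
    by have [sx|] := leP s' x; rewrite ?mul0r // powR_inv1 // (le_trans _ sx) // ltW.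
  exists s'^-1 => x; rewrite kern_pos //.
  have [sx|] := leP s' x; last by rewrite mul0r lexx invr_ge0 ltW.
  have x0 := lt_le_trans s0 sx.
  by rewrite mul1r invr_ge0 ltW //= lef_pV2.
have [s0|s0|->] := ltgtP s 0; last 2 first.
- exact: pos.
- rewrite (_ : kern 0 = cst 0); last by apply/funext => x; rewrite kern0.
  by split; [exact: measurable_cst | exists 0 => x; rewrite lexx].
have [|mk [M hM]] := pos (- s); first by rewrite oppr_gt0.
rewrite (_ : kern s = kern (- s) \o -%R); last by apply/funext => x /=; rewrite kernN.
split; last by exists M => x; exact: hM.
by apply: measurableT_comp.
Qed.

Lemma kernX_pos s x k : 0 < s -> kern s x ^+ k.+1 = (s <= x)%R%:R * x ^- k.+1.
Proof.
move=> s0; rewrite kern_pos // exprMn exprVn; congr (_ * _).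
by case: (s <= x); rewrite ?expr1n // expr0n.
Qed.

Lemma kern_max s y x k : 0 < s -> 0 < y ->
  kern s x * kern y x ^+ k.+1 = kern (Num.max s y) x ^+ k.+2.
Proof.
move=> s0 y0; have m0 : 0 < Num.max s y by rewrite lt_max s0.
rewrite !kernX_pos // kern_pos // ge_max -!exprVn.
by case: (s <= x); case: (y <= x); rewrite ?(mul0r, mulr0) // !mul1r -exprS.
Qed.

Lemma kern_min s y x k : s < 0 -> y < 0 ->
  kern s x * kern y x ^+ k.+1 = kern (Num.min s y) x ^+ k.+2.
Proof.
move=> s0 y0; rewrite -(kernN s) -(kernN y) kern_max ?oppr_gt0 //.
by rewrite -oppr_min kernN.
Qed.

(** Kernels of positive observations agree on the intersection of their supports,
    which is the support of the kernel of the largest observation. *)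
Lemma prod_kern_max (I : finType) (A : {set I}) (v : I -> R) y x :
  (forall i, i \in A -> 0 < v i <= y) -> (exists2 i, i \in A & v i = y) ->
  \prod_(i in A) kern (v i) x = kern y x ^+ #|A|.
Proof.
move=> h [j jA vj]; have /andP[y0 _] := h _ jA; rewrite vj in y0.
have [yx|yx] := leP y x.
  rewrite (eq_bigr (fun=> kern y x)) ?prodr_const // => i /h /andP[vi0 viy].
  by rewrite !kern_pos // yx (le_trans viy yx).
have ky : kern y x = 0 by rewrite kern_pos // leNgt yx mul0r.
rewrite (bigD1 j) //= vj ky mul0r expr0n; case: eqP => // A0.
by move: jA; rewrite (cards0_eq A0) inE.
Qed.

Lemma prod_kern_min (I : finType) (A : {set I}) (v : I -> R) z x :
  (forall i, i \in A -> z <= v i < 0) -> (exists2 i, i \in A & v i = z) ->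
  \prod_(i in A) kern (v i) x = kern z x ^+ #|A|.
Proof.
move=> h [j jA vj]; rewrite -kernN -(@prod_kern_max _ A (fun i => - v i)).
- by apply: eq_bigr => i _; rewrite kernN.
- by move=> i /h /andP[zv v0]; rewrite oppr_gt0 v0 lerN2.
- by exists j; rewrite ?vj.
Qed.

Variable H : probability R R.

Lemma upper_int_kern k y : 0 < y -> upper_int H k.+1 y = \int[H]_x kern y x ^+ k.+1.
Proof.
move=> y0; rewrite /upper_int Rintegral_mkcond; apply: eq_Rintegral => x _.
rewrite kernX_pos // /patch mem_setE in_itv /= andbT.
by case: ifP => _; rewrite ?mul1r ?mul0r.
Qed.

Lemma lower_int_kern k z : z < 0 -> lower_int H k.+1 z = \int[H]_x kern z x ^+ k.+1.
Proof.
move=> z0; rewrite /lower_int Rintegral_mkcond; apply: eq_Rintegral => x _.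
rewrite -kernN kernX_pos ?oppr_gt0 // lerN2 /patch mem_setE in_itv /=.
by case: ifP => _; rewrite ?mul1r ?mul0r.
Qed.

(** For a cell integral f and the kernel g of the new point: g is bounded, so that
    the product is dominated by a multiple of f. *)
Lemma Rintegral_mul_eq0 (f g : R -> R) : bounded_density f -> bounded_density g ->
  \int[H]_x f x = 0 -> \int[H]_x (g x * f x) = 0.
Proof.
move=> bf [mg [M hM]] f0; have [mf _] := bf.
have ge0 x : 0 <= f x by exact: bounded_density_ge0.
have M0 : 0 <= M by case/andP: (hM 0) => a b; exact: le_trans a b.
have If0 : (\int[H]_x (f x)%:E = 0)%E.
  by rewrite -[LHS]fineK; [congr EFin | apply: bounded_density_fin => //; exact: probability_setT].
suff : (\int[H]_x (g x * f x)%:E = 0)%E by rewrite /Rintegral => ->.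
apply/eqP; rewrite eq_le; apply/andP; split; last first.
  apply: integral_ge0 => x _; rewrite lee_fin mulr_ge0 //.
  by case/andP: (hM x).
have <- : (M%:E * \int[H]_x (f x)%:E = 0)%E by rewrite If0 mule0.
rewrite -ge0_integralZl_EFin //; last 2 first.
- by move=> x _; rewrite lee_fin.
- exact/measurable_EFinP.
apply: ge0_le_integral => //.
- by move=> x _; rewrite lee_fin mulr_ge0 //; case/andP: (hM x).
- by apply/measurable_EFinP; exact: measurable_funM.
- by apply: emeasurable_funM => //; exact/measurable_EFinP.
- by move=> x _; rewrite -EFinM lee_fin ler_wpM2r //; case/andP: (hM x).
Qed.

Lemma bounded_density_kernX y k : bounded_density (fun x => kern y x ^+ k).
Proof.
have := @bounded_density_prod R _ (iota 0 k) xpredT (fun=> kern y)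
  (fun=> bounded_density_kern y).
rewrite (_ : (fun x => \prod_(i <- _ | _) _) = fun x => kern y x ^+ k) //.
by apply/funext => x; rewrite big_const_seq count_predT size_iota -Monoid.iteropE.
Qed.

End Kernel.

(** * Observations and cell integrals *)

Section Points.
Context (R : realType) (theta : R) (N : nat) (T : N.-tuple R).
Hypothesis Ttheta : theta \notin T.

Local Notation n := (npos theta T).
Local Notation m := (N - npos theta T)%N.

Lemma perm_Ypos_Zneg : perm_eq (Ypos theta T ++ Zneg theta T) [seq s - theta | s <- T].
Proof.
have e : perm_eq (Ypos theta T ++ Zneg theta T)
    ([seq x <- [seq s - theta | s <- T] | 0 < x] ++ [seq x <- [seq s - theta | s <- T] | x < 0]).
  by apply: perm_cat; rewrite perm_sort.
apply: perm_trans e _.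
have h : perm_eq ([seq x <- [seq s - theta | s <- T] | 0 < x]
    ++ [seq x <- [seq s - theta | s <- T] | predC (fun x : R => 0 < x) x])
    [seq s - theta | s <- T] by apply/permPl/perm_filterC.
apply: perm_trans _ h; rewrite perm_cat2l.
rewrite (eq_in_filter (a2 := predC (fun x : R => 0 < x))) // => _ /mapP[s sT ->] /=.
rewrite -leNgt le_eqVlt subr_eq0.
by have [es|//] := eqVneq s theta; move: Ttheta; rewrite -es sT.
Qed.

Lemma size_Zneg : size (Zneg theta T) = m.
Proof.
have := perm_size perm_Ypos_Zneg; rewrite size_cat size_map size_tuple.
by move=> /(congr1 (subn^~ n)); rewrite addKn.
Qed.

Lemma Ypos_gt0 i : (i < n)%N -> 0 < nth 0 (Ypos theta T) i.
Proof.
move=> /(mem_nth 0); rewrite mem_sort mem_filter => /andP[] //.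
Qed.

Lemma Zneg_lt0 i : (i < m)%N -> nth 0 (Zneg theta T) i < 0.
Proof.
rewrite -size_Zneg => /(mem_nth 0); rewrite mem_sort mem_filter => /andP[] //.
Qed.

Lemma Ypos_le i j : (i <= j)%N -> (j < n)%N ->
  nth 0 (Ypos theta T) i <= nth 0 (Ypos theta T) j.
Proof.
move=> ij jn; apply: (sorted_leq_nth (leT := <=%R)) => //.
- exact: le_trans.
- by apply: sort_sorted => x y; exact: le_total.
- by rewrite inE (leq_ltn_trans ij).
Qed.

Lemma Zneg_ge i j : (i <= j)%N -> (j < m)%N ->
  nth 0 (Zneg theta T) j <= nth 0 (Zneg theta T) i.
Proof.
rewrite -size_Zneg => ij jn; apply: (sorted_leq_nth (leT := >=%R)) => //.
- by move=> x y z /= yx zy; exact: le_trans zy yx.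
- by move=> x; exact: lexx.
- by apply: sort_sorted => x y; exact: le_total.
- by rewrite inE (leq_ltn_trans ij).
Qed.

Lemma likelihood_points (G : {measure set R -> \bar R}) :
  likelihood G theta T =
  \prod_(i < n + m) \int[G]_x kern (nth 0 (Ypos theta T ++ Zneg theta T) i) x.
Proof.
rewrite /likelihood -(big_tuple _ _ T xpredT (density G theta)).
rewrite -(big_map (fun s => s - theta) xpredT (fun y => \int[G]_x kern y x)).
rewrite -(perm_big _ perm_Ypos_Zneg) /= (big_nth 0) big_mkord size_cat.
by rewrite size_Zneg.
Qed.

End Points.

Section CellIntegrals.
Context (R : realType) (H : probability R R) (theta : R) (N : nat) (T : N.-tuple R).
Hypothesis Ttheta : theta \notin T.
Variable s : R.

Local Notation n := (npos theta T).
Local Notation m := (N - npos theta T)%N.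

(** Index 0 is the new point; the positive and the negative observations follow. *)
Definition sample_kern (i : nat) : R -> R :=
  if i is j.+1 then kern (nth 0 (Ypos theta T ++ Zneg theta T) j) else kern s.

Lemma bounded_density_sample_kern i : bounded_density (sample_kern i).
Proof. by case: i => [|i]; exact: bounded_density_kern. Qed.

Lemma kern_lshift (i : 'I_n) :
  nth 0 (Ypos theta T ++ Zneg theta T) (lshift m i) = nth 0 (Ypos theta T) i.
Proof. by rewrite nth_cat /= -/n ltn_ord. Qed.

Lemma kern_rshift (i : 'I_m) :
  nth 0 (Ypos theta T ++ Zneg theta T) (rshift n i) = nth 0 (Zneg theta T) i.
Proof. by rewrite nth_cat /= -/n ltnNge leq_addr /= addKn. Qed.

Lemma prod_kern_lshift (C : {set 'I_n}) x : C != finset.set0 ->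
  \prod_(i in @lshift n m @: C) kern (nth 0 (Ypos theta T ++ Zneg theta T) i) x =
  kern (Yj theta T (cell_top C).+1) x ^+ #|C|.
Proof.
move=> C0; have [j jC ej] := cell_top_mem C0.
rewrite big_imset /=; last by move=> ? ? _ _; exact: lshift_inj.
rewrite (eq_bigr (fun i : 'I_n => kern (nth 0 (Ypos theta T) i) x)); last first.
  by move=> i _; rewrite kern_lshift.
rewrite /Yj /= ej; apply: prod_kern_max => [i iC|]; last by exists j.
by rewrite Ypos_gt0 // Ypos_le // -ej leq_cell_top.
Qed.

Lemma prod_kern_rshift (C : {set 'I_m}) x : C != finset.set0 ->
  \prod_(i in @rshift n m @: C) kern (nth 0 (Ypos theta T ++ Zneg theta T) i) x =
  kern (Zj theta T (cell_top C).+1) x ^+ #|C|.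
Proof.
move=> C0; have [j jC ej] := cell_top_mem C0.
rewrite big_imset /=; last by move=> ? ? _ _; exact: rshift_inj.
rewrite (eq_bigr (fun i : 'I_m => kern (nth 0 (Zneg theta T) i) x)); last first.
  by move=> i _; rewrite kern_rshift.
rewrite /Zj /= ej; apply: prod_kern_min => [i iC|]; last by exists j.
by rewrite Zneg_lt0 // Zneg_ge // -ej leq_cell_top.
Qed.

(** Kernels of observations of opposite signs have disjoint supports. *)
Lemma prod_kern_straddles (C : {set 'I_(n + m)}) x : straddles C ->
  \prod_(i in C) kern (nth 0 (Ypos theta T ++ Zneg theta T) i) x = 0.
Proof.
move=> /andP[/subsetPn[i iC il] /subsetPn[j jC jr]].
case: (split_ordP i) il iC => i' -> il iC; first by rewrite imset_f in il.
case: (split_ordP j) jr jC => j' -> jr jC; last by rewrite imset_f in jr.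
rewrite (bigD1 _ iC) (bigD1 (lshift m j')); last by rewrite [X in X && _]jC eq_lrshift.
have /= el := kern_lshift j'; have /= er := kern_rshift i'.
rewrite /= el er mulrCA mulrA.
by rewrite kern_opp_sign ?mul0r // ?Ypos_gt0 ?Zneg_lt0.
Qed.

Lemma cell_integral_lift (C : {set 'I_(n + m)}) :
  cell_integral H sample_kern (lift ord0 @: C) =
  \int[H]_x \prod_(i in C) kern (nth 0 (Ypos theta T ++ Zneg theta T) i) x.
Proof.
apply: eq_Rintegral => x _; rewrite big_imset /=; last by move=> ? ? _ _; exact: lift_inj.
exact: eq_bigr.
Qed.

Lemma cell_integral_new (C : {set 'I_(n + m)}) :
  cell_integral H sample_kern (ord0 |: (lift ord0 @: C))%SET =
  \int[H]_x (kern s x * \prod_(i in C) kern (nth 0 (Ypos theta T ++ Zneg theta T) i) x).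
Proof.
apply: eq_Rintegral => x _; rewrite big_setU1 /=; last first.
  by apply/imsetP => -[i _ /eqP]; rewrite (negPf (neq_lift _ _)).
congr (_ * _); rewrite big_imset /=; last by move=> ? ? _ _; exact: lift_inj.
exact: eq_bigr.
Qed.

Definition pos_mass (j k : nat) : R := \int[H]_x kern (Yj theta T j) x ^+ k.
Definition neg_mass (j k : nat) : R := \int[H]_x kern (Zj theta T j) x ^+ k.
Definition pos_new_mass (j k : nat) : R :=
  \int[H]_x (kern s x * kern (Yj theta T j) x ^+ k).
Definition neg_new_mass (j k : nat) : R :=
  \int[H]_x (kern s x * kern (Zj theta T j) x ^+ k).

Lemma pos_massE j k : (0 < j <= n)%N -> pos_mass j k.+1 = upper_int H k.+1 (Yj theta T j).
Proof.
by case: j => // j /andP[_ jn]; rewrite upper_int_kern //; exact: Ypos_gt0.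
Qed.

Lemma neg_massE j k : (0 < j <= m)%N -> neg_mass j k.+1 = lower_int H k.+1 (Zj theta T j).
Proof.
by case: j => // j /andP[_ jn]; rewrite lower_int_kern //; exact: Zneg_lt0.
Qed.

Lemma pos_new_massE j k : (0 < j <= n)%N ->
  pos_new_mass j k.+1 = upper_int H k.+2 (Num.max s (Yj theta T j)) * (0 < s)%R%:R.
Proof.
case: j => // j /andP[_ jn]; have y0 : 0 < Yj theta T j.+1 by exact: Ypos_gt0.
rewrite /pos_new_mass; have [s0|s0|s0] := ltgtP 0 s.
- rewrite mulr1 upper_int_kern ?lt_max ?s0 //; apply: eq_Rintegral => x _.
  exact: kern_max.
- rewrite mulr0 (_ : (fun x => _) = cst 0) ?Rintegral_cst ?mul0r //.
  by apply/funext => x; rewrite exprS mulrA [kern s x * _]mulrC kern_opp_sign ?mul0r.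
- rewrite mulr0 (_ : (fun x => _) = cst 0) ?Rintegral_cst ?mul0r //.
  by apply/funext => x; rewrite -s0 kern0 mul0r.
Qed.

Lemma neg_new_massE j k : (0 < j <= m)%N ->
  neg_new_mass j k.+1 = lower_int H k.+2 (Num.min s (Zj theta T j)) * (s < 0)%R%:R.
Proof.
case: j => // j /andP[_ jn]; have z0 : Zj theta T j.+1 < 0 by exact: Zneg_lt0.
rewrite /neg_new_mass; have [s0|s0|s0] := ltgtP s 0.
- rewrite mulr1 lower_int_kern ?gt_min ?s0 //; apply: eq_Rintegral => x _.
  exact: kern_min.
- rewrite mulr0 (_ : (fun x => _) = cst 0) ?Rintegral_cst ?mul0r //.
  by apply/funext => x; rewrite exprS mulrA kern_opp_sign ?mul0r.
- rewrite mulr0 (_ : (fun x => _) = cst 0) ?Rintegral_cst ?mul0r //.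
  by apply/funext => x; rewrite s0 kern0 mul0r.
Qed.

Lemma new_massE :
  \int[H]_x kern s x = upper_int H 1 s * (0 < s)%R%:R + lower_int H 1 s * (s < 0)%R%:R.
Proof.
have [s0|s0|s0] := ltgtP 0 s.
- by rewrite mulr1 mulr0 addr0 upper_int_kern.
- by rewrite mulr1 mulr0 add0r lower_int_kern.
- rewrite !mulr0 addr0 (_ : kern s = cst 0) ?Rintegral_cst ?mul0r //.
  by apply/funext => x; rewrite -s0 kern0.
Qed.

End CellIntegrals.

(** * The posterior mean *)

Theorem corollary2p3 (d : measure_display) (Omega : measurableType d)
    (R : realType) (P : probability Omega R) (H : probability R R)
    (K : pred nat) (W xi : nat -> {RV P >-> R}) (G : R.-pker Omega ~> R)
    (chi : seq nat -> R)
    (hG : species_sampling_model H K W xi G) (hchi : is_eppf P G chi)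
    (theta : R) (N : nat) (T : N.-tuple R)
    (Tuniq : uniq T) (Ttheta : theta \notin T)
    (Tpos : 0 < marginal_density P G theta T) (t : R) :
  posterior_mean P G theta T (fun w => density (G w) theta t)
  = \sum_(Sp : int_path (npos theta T) | is_Spath Sp)
      \sum_(Sm : int_path (N - npos theta T) | is_Spath Sm)
        a_f H chi t Sm Sp * path_distr H chi Sm Sp.
Proof.
set n := npos theta T; set m := (N - n)%N; pose s := t - theta.
pose k := sample_kern theta T s.
have bk i : bounded_density (k i) by exact: bounded_density_sample_kern.
have chi_perm e e' : all (leq 1%N) e -> perm_eq e e' -> chi e = chi e'.
  exact: (eppf_perm hchi).
have chi_new e : all (leq 1%N) e -> chi e = 0 -> chi (1%N :: e) = 0.
  by move=> e1 c0; exact: (@eppf_cons0 _ _ _ _ _ _ _ _ _ hG _ hchi 0%N e e1 c0).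
have chi_grow j e : all (leq 1%N) e -> chi (j.+1 :: e) = 0 -> chi (j.+2 :: e) = 0.
  by move=> e1 c0; exact: (@eppf_cons0 _ _ _ _ _ _ _ _ _ hG _ hchi j.+1 e e1 c0).
have chi_cat e e' : all (leq 1%N) e -> all (leq 1%N) e' -> chi e = 0 -> chi (e ++ e') = 0.
  exact: (eppf_cat0 hG hchi).
pose u := pos_mass H theta T; pose l := neg_mass H theta T.
pose U := pos_new_mass H theta T s; pose L := neg_new_mass H theta T s.
pose c (C : {set 'I_(n + m)}) := cell_integral H k (lift ord0 @: C).
pose h (C : {set 'I_(n + m)}) := cell_integral H k (ord0 |: (lift ord0 @: C))%SET.
have c_l (C : {set 'I_n}) : C != finset.set0 -> c (@lshift n m @: C) = u (cell_top C).+1 #|C|.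
  move=> C0; rewrite /c cell_integral_lift; apply: eq_Rintegral => x _.
  exact: prod_kern_lshift.
have c_r (C : {set 'I_m}) : C != finset.set0 -> c (@rshift n m @: C) = l (cell_top C).+1 #|C|.
  move=> C0; rewrite /c cell_integral_lift; apply: eq_Rintegral => x _.
  exact: prod_kern_rshift.
have h_l (C : {set 'I_n}) : C != finset.set0 -> h (@lshift n m @: C) = U (cell_top C).+1 #|C|.
  move=> C0; rewrite /h cell_integral_new; apply: eq_Rintegral => x _.
  by rewrite prod_kern_lshift.
have h_r (C : {set 'I_m}) : C != finset.set0 -> h (@rshift n m @: C) = L (cell_top C).+1 #|C|.
  move=> C0; rewrite /h cell_integral_new; apply: eq_Rintegral => x _.
  by rewrite prod_kern_rshift.
have c_str C : straddles C -> c C = 0.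
  move=> sC; rewrite /c cell_integral_lift -[RHS](mul0r (fine (H setT))) -Rintegral_cst //.
  by apply: eq_Rintegral => x _; exact: prod_kern_straddles.
have h_str C : straddles C -> h C = 0.
  move=> sC; rewrite /h cell_integral_new -[RHS](mul0r (fine (H setT))) -Rintegral_cst //.
  by apply: eq_Rintegral => x _; rewrite prod_kern_straddles // mulr0.
have uU (C : {set 'I_n}) : C != finset.set0 ->
    u (cell_top C).+1 #|C| = 0 -> U (cell_top C).+1 #|C| = 0.
  by move=> _; apply: Rintegral_mul_eq0; [exact: bounded_density_kernX|exact: bounded_density_kern].
have lL (C : {set 'I_m}) : C != finset.set0 ->
    l (cell_top C).+1 #|C| = 0 -> L (cell_top C).+1 #|C| = 0.
  by move=> _; apply: Rintegral_mul_eq0; [exact: bounded_density_kernX|exact: bounded_density_kern].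
have incrS n' (S : int_path n') j : jump S j -> incr S j = (incr S j).-1.+1.
  by move=> jS; rewrite prednK // subn_gt0.
have weightE (Sp : int_path n) (Sm : int_path m) :
    path_weight chi u l Sp Sm * (#|partitions_of_path Sp|%:R * #|partitions_of_path Sm|%:R)
    = phi_pos H chi Sp * phi_neg H chi Sm Sp.
  rewrite /path_weight /phi_pos /phi_neg -/n -/m.
  have -> : \prod_(1 <= j < n.+1 | jump Sp j) upper_int H (incr Sp j) (Yj theta T j) =
      \prod_(1 <= j < n.+1 | jump Sp j) u j (incr Sp j).
    rewrite big_nat_cond [RHS]big_nat_cond; apply: eq_bigr => j /andP[jn jS]; rewrite (incrS _ _ _ jS).
    by rewrite /u pos_massE.
  have -> : \prod_(1 <= j < m.+1 | jump Sm j) lower_int H (incr Sm j) (Zj theta T j) =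
      \prod_(1 <= j < m.+1 | jump Sm j) l j (incr Sm j).
    rewrite big_nat_cond [RHS]big_nat_cond; apply: eq_bigr => j /andP[jn jS]; rewrite (incrS _ _ _ jS).
    by rewrite /l neg_massE.
  (* If chi vanishes on the positive cells alone, it vanishes on all cells. *)
  have [M0|M0] := eqVneq (chi (Mlist 1 n Sp)) 0; last by field.
  by rewrite chi_cat ?Mlist_gt0 // M0 !(mulr0, mul0r).
have predictionE (Sp : int_path n) (Sm : int_path m) :
    path_prediction chi (\int[H]_x kern s x) u U l L Sp Sm = a_f H chi t Sm Sp.
  rewrite /a_f !mulrDl addrACA !mulr_suml /path_prediction -[LHS]addrA; congr (_ + (_ + _)).
  - by rewrite new_massE // mulrDr /eta0 /d_pos0 /d_neg0 /s subr_gt0 subr_lt0 !mulrA.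
  - rewrite big_mkcond /= big_nat_cond [RHS]big_nat_cond.
    apply: eq_bigr => j /andP[jn _]; rewrite /eta_pos /d_pos.
    case: ifP => jS; last by rewrite !mul0r.
    rewrite (incrS _ _ _ jS) /U pos_new_massE // /u pos_massE //.
    rewrite /s subr_gt0. ring.
  - rewrite big_mkcond /= big_nat_cond [RHS]big_nat_cond.
    apply: eq_bigr => j /andP[jn _]; rewrite /eta_neg /d_neg.
    case: ifP => jS; last by rewrite !mul0r.
    rewrite (incrS _ _ _ jS) /L neg_new_massE // /l neg_massE //.
    rewrite /s subr_lt0. ring.
have marginalE : marginal_density P G theta T =
    \sum_(Sp : int_path n | is_Spath Sp) \sum_(Sm : int_path m | is_Spath Sm)
      phi_pos H chi Sp * phi_neg H chi Sm Sp.
  transitivity (\int[P]_w (\prod_(i < n + m) \int[G w]_x k i.+1 x)).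
    by apply: eq_Rintegral => w _; exact: likelihood_points.
  rewrite (@eppf_mixture _ _ _ _ _ _ _ _ _ hG _ hchi _ (fun i => k i.+1)) //.
  transitivity (\sum_(Sp : int_path n | is_Spath Sp) \sum_(Sm : int_path m | is_Spath Sm)
    path_weight chi u l Sp Sm
    * (#|partitions_of_path Sp|%:R * #|partitions_of_path Sm|%:R)); last first.
    by apply: eq_bigr => Sp _; apply: eq_bigr => Sm _; rewrite weightE.
  rewrite -(sum_partition_weight chi_perm c_l c_r c_str).
  apply: eq_bigr => p _; congr (_ * _); apply: eq_bigr => C _.
  by rewrite /c cell_integral_lift.
have numeratorE : \int[P]_w (density (G w) theta t * likelihood (G w) theta T) =
    \sum_(Sp : int_path n | is_Spath Sp) \sum_(Sm : int_path m | is_Spath Sm)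
      a_f H chi t Sm Sp * (phi_pos H chi Sp * phi_neg H chi Sm Sp).
  transitivity (\int[P]_w (\prod_(i < (n + m).+1) \int[G w]_x k i x)).
    by apply: eq_Rintegral => w _; rewrite big_ord_recl (likelihood_points Ttheta).
  rewrite (eppf_mixture hG hchi _ bk) (sum_partition_insert chi_perm).
  transitivity (\sum_(Sp : int_path n | is_Spath Sp) \sum_(Sm : int_path m | is_Spath Sm)
    path_prediction chi (\int[H]_x kern s x) u U l L Sp Sm * path_weight chi u l Sp Sm
    * (#|partitions_of_path Sp|%:R * #|partitions_of_path Sm|%:R)); last first.
    apply: eq_bigr => Sp _; apply: eq_bigr => Sm _.
    by rewrite -mulrA weightE predictionE.
  rewrite -(sum_partition_prediction chi_perm chi_new chi_grow (\int[H]_x kern s x)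
    c_l c_r h_l h_r c_str h_str uU lL).
  apply: eq_bigr => p _; congr (_ * _ * _ + _).
  by apply: eq_Rintegral => x _; rewrite big_set1.
rewrite /posterior_mean numeratorE marginalE mulr_suml; apply: eq_bigr => Sp _.
rewrite mulr_suml; apply: eq_bigr => Sm _.
by rewrite -mulrA.
Qed.
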